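(* Let $M$ be a closed orientable finite-dimensional manifold with a volume form $\mathrm{vol}_M$, and let $(N,g_N)$ be a connected weak Riemannian diffeological space. Let $g$ be the weak Riemannian metric on $(C^\infty(M,N),\mathcal{D}_{\mathrm{func}})$ given by $$g(P)_r(v,w)=\int_M g_N(\mathrm{ev}_m\circ P)_r(v,w)\,\mathrm{vol}_M$$ for every plot $P\in\mathcal{D}_{\mathrm{func}}$, $r\in U_P$, $v,w\in T_rU_P$. If the pseudodistance $d_N$ on $N$ defined by $g_N$ is a distance, then the pseudodistance $d$ on $C^\infty(M,N)$ defined by $g$ is a distance.
   Context: A domain is an open subset of some $\mathbb{R}^n$, $n\ge 0$. A diffeology $\mathcal{D}$ on a set $X$ is a set of maps $P\colon U_P\to X$ from domains (called plots) that contains all constant maps from domains, is closed under precomposition with smooth maps between domains, and is local (a map $U\to X$ from a domain whose restrictions to the members of some open cover of $U$ are plots is a plot). A map between diffeological spaces is smooth if its composite with every plot is a plot. Manifolds carry the standard diffeology of all usual smooth maps from domains. The product diffeology on $X\times Y$ consists of the maps from domains whose components are plots. Tangent construction: regard $\mathcal{D}$ as a category whose objects are plots and whose morphisms $P\to Q$ are smooth $h\colon U_P\to U_Q$ with $Q\circ h=P$. Put $T_2(X)=\operatorname{colim}_{P\in\mathcal{D}}(U_P\times\mathbb{R}^{\dim U_P}\times\mathbb{R}^{\dim U_P})$, where $h$ acts by $(r,v,w)\mapsto(h(r),Jh_rv,Jh_rw)$. A weak Riemannian metric on $X$ is a map $g\colon T_2(X)\to\mathbb{R}$ such that for every plot $P$,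 $g(P)_r(v,w):=g([r,v,w]_P)$ is a smooth symmetric covariant $2$-tensor on $U_P$ with $g(P)_r(v,v)\ge 0$. The functional diffeology $\mathcal{D}_{\mathrm{func}}$ on the set $C^\infty(M,N)$ of smooth maps consists of the maps $P\colon U_P\to C^\infty(M,N)$ whose adjoint $U_P\times M\to N$, $(r,m)\mapsto P(r)(m)$, is smooth. $\mathrm{ev}_m\colon C^\infty(M,N)\to N$ is evaluation at $m$. Pseudodistance defined by a weak Riemannian metric $g$ on $X$: $d(x,y)=\inf_\gamma\ell(\gamma)\in[0,\infty]$, infimum over smooth $\gamma\colon\mathbb{R}\to X$ with $\gamma(0)=x$, $\gamma(1)=y$, $\ell(\gamma)=\int_0^1(g(\gamma)_t(1,1))^{1/2}dt$, and $d(x,y)=\infty$ if there is no such path. $X$ is connected if any two points are joined by such a path. $d$ is called a distance if $d(x,y)=0$ implies $x=y$ (the value $\infty$ being allowed). *)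

(* Defs.v *)
From HB Require Import structures.
From mathcomp Require Import all_boot all_order all_algebra.
From Stdlib Require List Relation_Operators.
From mathcomp Require Import all_classical all_reals all_analysis.
Import numFieldNormedType.Exports.
Import Order.TTheory GRing.Theory Num.Theory.
Set Implicit Arguments. Unset Strict Implicit. Unset Printing Implicit Defensive.
Local Open Scope classical_set_scope.
Local Open Scope ring_scope.

Section Smooth.
Variable R : realType.
Section Target.
Variables (m : nat) (V : normedModType R).
Implicit Types (U : set 'rV[R]_m) (f : 'rV[R]_m -> V).

(* Only the germ of f at the points of U matters; U is meant to be open. *)
Fixpoint Ck (k : nat) U f : Prop :=
  if k is k'.+1 then
    (forall x, U x -> differentiable f x) /\ (forall v, Ck k' U ('D_v f))
  else forall x, U x -> {for x, continuous f}.

Definition smooth_on U f := forall k, Ck k U f.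

Lemma CkW k U f : Ck k.+1 U f -> Ck k U f.
Proof.
elim: k f => [f [df _] x Ux|k IH f [df Df]].
  exact/differentiable_continuous/df.
by split=> // v; apply: IH; exact: Df.
Qed.

Lemma Ck_local k U f :
  (forall x, U x -> exists2 W, W x & Ck k W f) -> Ck k U f.
Proof.
elim: k f => [f H x /H[W Wx cf]|k IH f H]; first exact: cf.
split=> [x /H[W Wx [df _]]|v]; first exact: df.
by apply: IH => x /H[W Wx [_ Df]]; exists W => //; exact: Df.
Qed.

Lemma Ck_sub k U U' f : U' `<=` U -> Ck k U f -> Ck k U' f.
Proof. by move=> sU Uf; apply: Ck_local => x /sU Ux; exists U. Qed.

Lemma near_eq_differentiable (f g : 'rV[R]_m -> V) x :
  (\near x, f x = g x) -> differentiable f x -> differentiable g x.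
Proof.
move=> fg df.
have ex : (g \o shift x = cst (g x) + 'd f x +o_ 0 id).
  apply/eqaddoP => _/posnumP[e].
  have /eqaddoP/(_ _ (gt0 e)) H := diff_locally df.
  have fg0 : \forall h \near 0, f (h + x) = g (h + x).
    by move: fg; rewrite [X in X -> _](near_shift 0) /= subr0.
  near=> h.
  have E : f (h + x) = g (h + x) by near: h.
  have Ex : f x = g x by exact: nbhs_singleton fg.
  rewrite /= !fctE /= -E -Ex.
  by near: h; exact: H.
have dE : 'd g x = 'd f x :> ('rV[R]_m -> V).
  by apply: diff_unique ex; exact: diff_continuous.
apply/diff_locallyP; rewrite dE; split => //.
exact: diff_continuous.
Unshelve. all: by end_near. Qed.

Lemma Ck_ext k U f g : open U -> (forall x, U x -> f x = g x) ->
  Ck k U f -> Ck k U g.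
Proof.
move=> oU; elim: k f g => [f g fg Cf x Ux|k IH f g fg [df Df]].
  have nfg : \near x, f x = g x.
    by apply: filterS fg _; apply: open_nbhs_nbhs.
  move: (Cf x Ux); rewrite /prop_for /continuous_at (fg x Ux).
  by apply: cvg_trans; exact: near_eq_cvg nfg.
have nfg x : U x -> \near x, f x = g x.
  by move=> Ux; apply: filterS fg _; exact: open_nbhs_nbhs.
split=> [x Ux|v]; first exact: near_eq_differentiable (nfg x Ux) (df x Ux).
apply: (IH ('D_v f)) => [x Ux|]; last exact: Df.
by apply: near_eq_derive; exact: nfg.
Qed.

Lemma Ck_cst k U (c : V) : open U -> Ck k U (cst c).
Proof.
move=> oU; elim: k c => [|k IH] c; first by move=> x _; exact: cst_continuous.
split=> [x _|v]; first exact: differentiable_cst.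
by apply: (Ck_ext oU _ (IH 0)) => x _; rewrite derive_cst.
Qed.

Lemma CkD k U f g : open U -> Ck k U f -> Ck k U g -> Ck k U (f + g).
Proof.
move=> oU; elim: k f g => [f g cf cg x Ux|k IH f g [df Df] [dg Dg]].
  by apply: continuousD; [exact: cf|exact: cg].
split=> [x Ux|v]; first by apply: differentiableD; [exact: df|exact: dg].
apply: (Ck_ext oU _ (IH _ _ (Df v) (Dg v))) => x Ux.
by rewrite deriveD//; apply: diff_derivable; [exact: df|exact: dg].
Qed.

Lemma Ck_sum k U n (F : 'I_n -> 'rV[R]_m -> V) : open U ->
  (forall i, Ck k U (F i)) -> Ck k U (\sum_(i < n) F i).
Proof.
move=> oU CF; elim/big_ind: _ => // [|f g]; first exact: Ck_cst.
exact: CkD.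
Qed.

End Target.

Lemma scale_is_diff (V : normedModType R) (p : R * V) :
  differentiable (fun q : R * V => q.1 *: q.2) p /\
  'd (fun q : R * V => q.1 *: q.2) p = (fun q => p.1 *: q.2 + q.1 *: p.2)
     :> (R * V -> V).
Proof.
have bil : bilinear_for (GRing.Scale.Law.clone _ _ *:%R _)
   (GRing.Scale.Law.clone _ _ *:%R _) (@GRing.scale R V : R -> V -> V).
  split=> [u'|u] a x y /=.
  - by rewrite scalerDl scalerA.
  - by rewrite scalerDr !scalerA mulrC.
pose M := bilinear_isBilinear.Build R R V V _ _ (@GRing.scale R V : R -> V -> V) bil.
pose B : {bilinear R -> V -> V} := HB.pack (@GRing.scale R V : R -> V -> V) M.
have cB : continuous (fun q : R * V => B q.1 q.2) by exact: scale_continuous.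
split; first exact: (differentiable_bilin p cB).
exact: (diff_bilin p cB).
Qed.

Lemma Ck_scale k m (V : normedModType R) (U : set 'rV[R]_m)
    (a : 'rV[R]_m -> R) (f : 'rV[R]_m -> V) :
  open U -> Ck k U a -> Ck k U f -> Ck k U (fun x => a x *: f x).
Proof.
move=> oU; elim: k a f => [a f ca cf x Ux|k IH a f Ca Cf].
  by apply: continuousZ; [exact: ca|exact: cf].
have [[da Da] [df Df]] := (Ca, Cf).
have E x : U x -> differentiable (fun x => (a x, f x)) x.
  by move=> Ux; apply: differentiable_pair; [exact: da|exact: df].
pose s := fun q : R * V => q.1 *: q.2.
have dd x : U x -> differentiable (fun x => a x *: f x) x.
  move=> Ux; rewrite -[fun x => _]/(s \o (fun x => (a x, f x))).
  apply: differentiable_comp; first exact: E.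
  exact: (scale_is_diff _).1.
split=> // v.
apply: (Ck_ext oU _ (CkD oU (IH _ _ (CkW Ca) (Df v)) (IH _ _ (Da v) (CkW Cf)))).
move=> x Ux; rewrite [RHS]deriveE; last exact: dd.
rewrite -[fun x => _ in RHS]/(s \o (fun x => (a x, f x))).
rewrite diff_comp; [|exact: E|exact: (scale_is_diff _).1].
rewrite /= (scale_is_diff _).2 diff_pair; [|exact: da|exact: df].
rewrite /= -(deriveE v (da x Ux)) -(deriveE v (df x Ux)).
by [].
Qed.

Lemma Ck_lin k m (V W : normedModType R) (U : set 'rV[R]_m)
    (L : {linear V -> W}) (f : 'rV[R]_m -> V) :
  continuous L -> open U -> Ck k U f -> Ck k U (L \o f).
Proof.
move=> cL oU; elim: k f => [f cf x Ux|k IH f [df Df]].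
  by apply: continuous_comp; [exact: cf|exact: cL].
split=> [x Ux|v].
  by apply: differentiable_comp; [exact: df|exact: linear_differentiable].
apply: (Ck_ext oU _ (IH _ (Df v))) => x Ux /=.
have dL y : differentiable L y by exact: linear_differentiable.
rewrite [RHS]deriveE; last by apply: differentiable_comp => //; exact: df.
rewrite diff_comp //; last exact: df.
by rewrite /= diff_lin// deriveE//; exact: df.
Qed.

Lemma Ck_coord k m n (U : set 'rV[R]_m) (f : 'rV[R]_m -> 'rV[R]_n) i :
  open U -> Ck k U f -> Ck k U (fun x => f x ord0 i : R).
Proof.
have @L : {linear 'rV[R]_n -> R}.
  by exists (fun N : 'rV[R]_n => N ord0 i); do 2![eexists]; do ?[constructor];
     rewrite ?mxE// => ? *; rewrite ?mxE//; move=> ?; rewrite !mxE.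
move=> oU Cf; rewrite -[fun x => _]/(L \o f); apply: Ck_lin => //.
exact: coord_continuous.
Qed.

Lemma Ck_comp k m n (V : normedModType R) (U : set 'rV[R]_m)
    (W : set 'rV[R]_n) (f : 'rV[R]_m -> 'rV[R]_n) (g : 'rV[R]_n -> V) :
  open U -> (forall x, U x -> W (f x)) ->
  Ck k U f -> Ck k W g -> Ck k U (g \o f).
Proof.
move=> oU UW; elim: k g => [g cf cg x Ux|k IH g Cf [dg Dg]].
  by apply: continuous_comp; [exact: cf|apply: cg; exact: UW].
have [df Df] := Cf.
have dgf x : U x -> differentiable (g \o f) x.
  by move=> Ux; apply: differentiable_comp; [exact: df|apply: dg; exact: UW].
split=> // v.
have C : Ck k U (\sum_(i < n)
    fun x => ('D_v f x) ord0 i *: ('D_(delta_mx ord0 i) g \o f) x).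
  apply: Ck_sum => // i; apply: Ck_scale => //; first exact: (Ck_coord i oU (Df v)).
  by apply: IH; [exact: CkW|exact: Dg].
apply: (Ck_ext oU _ C) => x Ux.
rewrite [RHS]deriveE; last exact: dgf.
rewrite diff_comp; [|exact: df|apply: dg; exact: UW].
rewrite /= -(deriveE v (df x Ux)).
rewrite [in RHS](row_sum_delta ('D_v f x)) linear_sum fct_sumE.
have dgx : differentiable g (f x) by apply: dg; exact: UW.
by apply: eq_bigr => i _; rewrite linearZ /= -(deriveE _ dgx).
Qed.

Lemma Ck_id k m (U : set 'rV[R]_m) : open U -> Ck k U id.
Proof.
move=> oU; case: k => [|k]; first by move=> x _; move=> A.
split=> [x _|v]; first exact: ex_diff.
apply: (Ck_ext oU _ (Ck_cst k v oU)) => x _.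
by rewrite derive_id.
Qed.
End Smooth.

Section SmoothOn.
Context {R : realType}.

Lemma smooth_on_ext m (V : normedModType R) (U : set 'rV[R]_m)
    (f g : 'rV[R]_m -> V) :
  open U -> (forall x, U x -> f x = g x) -> smooth_on U f -> smooth_on U g.
Proof. by move=> oU fg sf k; apply: (Ck_ext oU fg). Qed.

Lemma smooth_on_comp m n (V : normedModType R) (U : set 'rV[R]_m)
    (W : set 'rV[R]_n) (f : 'rV[R]_m -> 'rV[R]_n) (g : 'rV[R]_n -> V) :
  open U -> (forall x, U x -> W (f x)) ->
  smooth_on U f -> smooth_on W g -> smooth_on U (g \o f).
Proof. by move=> oU UW sf sg k; apply: (Ck_comp oU UW). Qed.

Lemma smooth_on_sub m (V : normedModType R) (U U' : set 'rV[R]_m)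
    (f : 'rV[R]_m -> V) : U' `<=` U -> smooth_on U f -> smooth_on U' f.
Proof. by move=> sU sf k; apply: Ck_sub sU (sf k). Qed.

Lemma smooth_on_local m (V : normedModType R) (U : set 'rV[R]_m)
    (f : 'rV[R]_m -> V) :
  (forall x, U x -> exists2 W, W x & smooth_on W f) -> smooth_on U f.
Proof. by move=> H k; apply: Ck_local => x /H[W Wx sW]; exists W. Qed.

Lemma open_preimage_in (S T : topologicalType) (U : set S) (V : set T)
    (f : S -> T) : open U -> (forall x, U x -> {for x, continuous f}) ->
  open V -> open (U `&` f @^-1` V).
Proof.
move=> oU cf oV; rewrite openE => x [Ux Vfx]; apply: filterI.
  exact: open_nbhs_nbhs.
by apply: (cf x Ux); exact: open_nbhs_nbhs.
Qed.

End SmoothOn.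

Section Diffeology.
Variable R : realType.

(* A map from a domain U of R^n to X is represented by a total function on
   'rV[R]_n of which only the values on U matter (plot_ext). *)
Record diffeology (X : Type) := Diffeology {
  is_plot : forall n, set 'rV[R]_n -> ('rV[R]_n -> X) -> Prop ;
  plot_open : forall n (U : set 'rV[R]_n) p, is_plot U p -> open U ;
  plot_ext : forall n (U : set 'rV[R]_n) p q,
    (forall r, U r -> p r = q r) -> is_plot U p -> is_plot U q ;
  plot_cst : forall n (U : set 'rV[R]_n) x, open U -> is_plot U (fun=> x) ;
  plot_comp : forall n m (U : set 'rV[R]_n) (V : set 'rV[R]_m) h p,
    open V -> smooth_on V h -> (forall r, V r -> U (h r)) ->
    is_plot U p -> is_plot V (p \o h) ;
  plot_local : forall n (U : set 'rV[R]_n) p, open U ->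
    (forall r, U r -> exists V, [/\ open V, V r, V `<=` U & is_plot V p]) ->
    is_plot U p
}.

Record diffspace := Diffspace {
  diff_carrier :> Type ;
  diff_diffeology :> diffeology diff_carrier
}.

Record plot (X : diffspace) := Plot {
  pdim : nat ;
  pdom : set 'rV[R]_pdim ;
  pmap : 'rV[R]_pdim -> X ;
  pmapP : is_plot X pdom pmap
}.
Arguments pdom {X} p _.
Arguments pmap {X} p _.

Definition smooth (X Y : diffspace) (f : X -> Y) :=
  forall n (U : set 'rV[R]_n) p, is_plot X U p -> is_plot Y U (f \o p).

Definition plot_map (X Y : diffspace) (f : X -> Y) (sf : smooth f)
    (P : plot X) : plot Y := Plot (sf _ _ _ (pmapP P)).

Section Domain.
Variables (n : nat) (U : set 'rV[R]_n).

Let T := {x | U x}.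

Definition domain_plot m (V : set 'rV[R]_m) (p : 'rV[R]_m -> T) :=
  open V /\ smooth_on V (fun r => sval (p r)).

Let domain_plot_open m (V : set 'rV[R]_m) p : domain_plot V p -> open V.
Proof. by case. Qed.

Let domain_plot_ext m (V : set 'rV[R]_m) p q :
  (forall r, V r -> p r = q r) -> domain_plot V p -> domain_plot V q.
Proof.
move=> pq [oV sp]; split=> //; apply: (smooth_on_ext oV _ sp) => x Vx.
by rewrite pq.
Qed.

Let domain_plot_cst m (V : set 'rV[R]_m) x : open V -> domain_plot V (fun=> x).
Proof. by move=> oV; split=> // k; exact: Ck_cst. Qed.

Let domain_plot_comp m l (V : set 'rV[R]_m) (W : set 'rV[R]_l) h p :
  open W -> smooth_on W h -> (forall r, W r -> V (h r)) ->
  domain_plot V p -> domain_plot W (p \o h).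
Proof.
move=> oW sh hV [oV sp]; split=> //.
exact: (smooth_on_comp oW hV sh sp).
Qed.

Let domain_plot_local m (V : set 'rV[R]_m) p : open V ->
  (forall r, V r -> exists W, [/\ open W, W r, W `<=` V & domain_plot W p]) ->
  domain_plot V p.
Proof.
move=> oV H; split=> //; apply: smooth_on_local => x /H[W [_ Wx _ [_ sW]]].
by exists W.
Qed.

Definition domain_space : diffspace := Diffspace
  (Diffeology domain_plot_open domain_plot_ext domain_plot_cst
     domain_plot_comp domain_plot_local).

End Domain.

Section Product.
Variables X Y : diffspace.

Definition prod_plot n (U : set 'rV[R]_n) (p : 'rV[R]_n -> X * Y) :=
  is_plot X U (fun r => (p r).1) /\ is_plot Y U (fun r => (p r).2).

Let prod_plot_open n (U : set 'rV[R]_n) p : prod_plot U p -> open U.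
Proof. by case=> /plot_open. Qed.

Let prod_plot_ext n (U : set 'rV[R]_n) p q :
  (forall r, U r -> p r = q r) -> prod_plot U p -> prod_plot U q.
Proof.
by move=> pq [p1 p2]; split; [apply: plot_ext p1|apply: plot_ext p2];
  move=> r Ur; rewrite pq.
Qed.

Let prod_plot_cst n (U : set 'rV[R]_n) x : open U -> prod_plot U (fun=> x).
Proof. by move=> oU; split; exact: plot_cst. Qed.

Let prod_plot_comp n m (U : set 'rV[R]_n) (V : set 'rV[R]_m) h p :
  open V -> smooth_on V h -> (forall r, V r -> U (h r)) ->
  prod_plot U p -> prod_plot V (p \o h).
Proof.
move=> oV sh hU [p1 p2].
by split; [exact: plot_comp hU p1|exact: plot_comp hU p2].
Qed.

Let prod_plot_local n (U : set 'rV[R]_n) p : open U ->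
  (forall r, U r -> exists V, [/\ open V, V r, V `<=` U & prod_plot V p]) ->
  prod_plot U p.
Proof.
by move=> oU H; split; apply: plot_local => // r /H[V [oV Vr VU [p1 p2]]];
  exists V.
Qed.

Definition prod_space : diffspace := Diffspace
  (Diffeology prod_plot_open prod_plot_ext prod_plot_cst
     prod_plot_comp prod_plot_local).

End Product.

Section Functional.
Variables X Y : diffspace.

Definition smooth_map := {f : X -> Y | smooth f}.

Definition adjoint n (U : set 'rV[R]_n) (p : 'rV[R]_n -> smooth_map) :
  prod_space (domain_space U) X -> Y := fun z => sval (p (sval z.1)) z.2.

Definition func_plot n (U : set 'rV[R]_n) (p : 'rV[R]_n -> smooth_map) :=
  open U /\ smooth (@adjoint n U p).

Let func_plot_open n (U : set 'rV[R]_n) p : func_plot U p -> open U.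
Proof. by case. Qed.

Let func_plot_ext n (U : set 'rV[R]_n) p q :
  (forall r, U r -> p r = q r) -> func_plot U p -> func_plot U q.
Proof.
move=> pq [oU sp]; split=> //.
suff <- : adjoint p = adjoint (U := U) q by [].
by apply/funext => -[[r Ur] x]; rewrite /adjoint /= pq.
Qed.

Let func_plot_cst n (U : set 'rV[R]_n) f : open U -> func_plot U (fun=> f).
Proof. by move=> oU; split=> // m V p [_ p2]; exact: (svalP f _ _ _ p2). Qed.

Let func_plot_comp n m (U : set 'rV[R]_n) (V : set 'rV[R]_m) h p :
  open V -> smooth_on V h -> (forall r, V r -> U (h r)) ->
  func_plot U p -> func_plot V (p \o h).
Proof.
move=> oV sh hU [oU sp]; split=> // l W q [[oW q1] q2].
pose q' (x : 'rV[R]_l) : prod_space (domain_space U) X :=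
  (exist _ (h (sval (q x).1)) (hU _ (svalP (q x).1)), (q x).2).
have q'P : is_plot (prod_space (domain_space U) X) W q'.
  split=> //; split=> //=.
  apply: (smooth_on_comp (W := V) oW _ q1 sh) => x _.
  exact: svalP (q x).1.
exact: (sp _ _ _ q'P).
Qed.

Let func_plot_local n (U : set 'rV[R]_n) p : open U ->
  (forall r, U r -> exists V, [/\ open V, V r, V `<=` U & func_plot V p]) ->
  func_plot U p.
Proof.
move=> oU H; split=> // l W q [[oW q1] q2].
apply: plot_local => // x Wx.
have [V [oV Vx VU [_ sp]]] := H _ (svalP (q x).1).
pose W' := W `&` (fun y => sval (q y).1) @^-1` V.
have oW' : open W' by apply: open_preimage_in => //; exact: (q1 0%N).
have W'W : W' `<=` W by move=> y [].
exists W'; split=> //.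
pose q' (y : 'rV[R]_l) : prod_space (domain_space V) X :=
  (if pselect (V (sval (q y).1)) is left Vy then exist _ _ Vy
   else exist _ _ Vx, (q y).2).
have q'E y : W' y -> sval (q' y).1 = sval (q y).1.
  by case=> _ Vy; rewrite /q' /=; case: pselect.
have q'P : is_plot (prod_space (domain_space V) X) W' q'.
  split; last by apply: (plot_comp (h := id) oW' _ W'W q2) => k; exact: Ck_id.
  split=> //; apply: (smooth_on_ext oW' _ (smooth_on_sub W'W q1)) => y W'y.
  by rewrite q'E.
by apply: plot_ext (sp _ _ _ q'P) => y W'y; rewrite /= /adjoint q'E.
Qed.

Definition func_space : diffspace := Diffspace
  (Diffeology func_plot_open func_plot_ext func_plot_cst
     func_plot_comp func_plot_local).

Definition ev (x : X) (f : func_space) : Y := sval f x.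

Lemma ev_smooth (x : X) : smooth (ev x).
Proof.
move=> n U p [oU sp].
have [->|/set0P[r0 Ur0]] := eqVneq U set0.
  by apply: plot_local => //; exact: open0.
pose q (y : 'rV[R]_n) : prod_space (domain_space U) X :=
  (if pselect (U y) is left Uy then exist _ _ Uy else exist _ _ Ur0, x).
have qE y : U y -> sval (q y).1 = y by rewrite /q /=; case: pselect.
have qP : is_plot (prod_space (domain_space U) X) U q.
  split; last exact: plot_cst.
  split=> //; apply: (smooth_on_ext oU (f := id)) => [y Uy|k].
    by rewrite qE.
  exact: Ck_id.
by apply: plot_ext (sp _ _ _ qP) => y Uy; rewrite /= /adjoint /ev qE.
Qed.

End Functional.

End Diffeology.

Arguments ev_smooth {R} X Y x.
Arguments pdom {R X} p _.
Arguments pmap {R X} p _.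

Section WeakRiemannian.
Variables (R : realType) (X : diffspace R).

Record T2_pre := T2Pre {
  t2_plot : plot X ;
  t2_pt : 'rV[R]_(pdim t2_plot) ;
  t2_v : 'rV[R]_(pdim t2_plot) ;
  t2_w : 'rV[R]_(pdim t2_plot) ;
  t2_in : pdom t2_plot t2_pt
}.

(* The identification of (r, v, w) with (h r, Jh_r v, Jh_r w) along a morphism
   h of plots. Tangent vectors are rows and jacobians act on their right. *)
Definition T2_step (a b : T2_pre) : Prop :=
  let P := t2_plot a in let Q := t2_plot b in
  exists h : 'rV[R]_(pdim P) -> 'rV[R]_(pdim Q),
    [/\ smooth_on (pdom P) h,
        forall r, pdom P r -> pdom Q (h r),
        forall r, pdom P r -> pmap Q (h r) = pmap P r &
        [/\ t2_pt b = h (t2_pt a),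
            t2_v b = t2_v a *m jacobian h (t2_pt a) &
            t2_w b = t2_w a *m jacobian h (t2_pt a)]].

(* The colimit of sets: the quotient of T2_pre by the equivalence relation
   generated by T2_step. *)
Definition T2_eq : T2_pre -> set T2_pre :=
  Relation_Operators.clos_refl_sym_trans T2_pre T2_step.

Definition T2 := {C : set T2_pre | exists a, C = T2_eq a}.

Definition T2_class (a : T2_pre) : T2 := exist _ (T2_eq a) (ex_intro _ a erefl).

(* g(P)_r(v, w), with value 0 for r outside the domain of P *)
Definition tensor (g : T2 -> R) (P : plot X) (r v w : 'rV[R]_(pdim P)) : R :=
  if pselect (pdom P r) is left Pr then g (T2_class (T2Pre v w Pr)) else 0.
Arguments tensor g P r v w : clear implicits.

Record weak_riemannian := WeakRiemannian {
  wr_fun :> T2 -> R ;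
  wr_sym : forall P r v w, pdom P r ->
    tensor wr_fun P r v w = tensor wr_fun P r w v ;
  wr_lin : forall P r a u v w, pdom P r ->
    tensor wr_fun P r (a *: u + v) w =
    a * tensor wr_fun P r u w + tensor wr_fun P r v w ;
  wr_smooth : forall P v w,
    smooth_on (pdom P) (fun r => tensor wr_fun P r v w) ;
  wr_ge0 : forall P r v, pdom P r -> 0 <= tensor wr_fun P r v v
}.

(* The line R is identified with R^1, so that a smooth path is a plot. *)
Record path (x y : X) := Path {
  path_fun :> R -> X ;
  path_smooth : is_plot X setT (fun t : 'rV[R]_1 => path_fun (t ord0 ord0)) ;
  path0 : path_fun 0 = x ;
  path1 : path_fun 1 = y
}.

Definition path_plot x y (c : path x y) : plot X := Plot (path_smooth c).

Definition path_length (g : weak_riemannian) x y (c : path x y) : \bar R :=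
  \int[@lebesgue_measure R]_(t in `[0%R, 1%R])
    (Num.sqrt (tensor g (path_plot c) (const_mx t)
       (const_mx 1) (const_mx 1)))%:E.

Definition pseudodist (g : weak_riemannian) (x y : X) : \bar R :=
  ereal_inf [set path_length g c | c in [set: path x y]].

Definition diff_connected := forall x y : X, inhabited (path x y).

End WeakRiemannian.

Arguments tensor {R X} g P r v w.

Definition is_distance (R : realType) (T : Type) (d : T -> T -> \bar R) :=
  forall x y, d x y = 0%E -> x = y.

Section Manifold.
Variable R : realType.

Record chart (M : topologicalType) (n : nat) := Chart {
  cdom : set M ;
  cmap : M -> 'rV[R]_n ;
  cinv : 'rV[R]_n -> M ;
  cdom_open : open cdom ;
  cimage_open : open (cmap @` cdom) ;
  cmap_cont : forall x, cdom x -> {for x, continuous cmap} ;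
  cinv_cont : forall u, (cmap @` cdom) u -> {for u, continuous cinv} ;
  cmapK : forall x, cdom x -> cinv (cmap x) = x
}.

Definition transition (M : topologicalType) n (c d : chart M n) :
  'rV[R]_n -> 'rV[R]_n := cmap d \o cinv c.

Definition compatible (M : topologicalType) n (c d : chart M n) :=
  smooth_on (cmap c @` (cdom c `&` cdom d)) (transition c d).

Record manifold := Manifold {
  mcarrier :> topologicalType ;
  mdim : nat ;
  atlas : set (chart mcarrier mdim) ;
  atlas_cover : forall x : mcarrier, exists2 c, atlas c & cdom c x ;
  atlas_compatible : forall c d, atlas c -> atlas d -> compatible c d ;
  mhausdorff : hausdorff_space mcarrier ;
  msecond_countable : @second_countable mcarrier
}.

(* Charts map onto open subsets of R^n, so that a manifold has no boundary. *)
Record closed_manifold := ClosedManifold {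
  cm_manifold :> manifold ;
  cm_compact : compact [set: cm_manifold]
}.

Definition orientable (M : manifold) :=
  exists A : set (chart M (mdim M)),
    [/\ forall x : M, exists2 c, A c & cdom c x,
        forall c d, A c -> atlas d -> compatible c d /\ compatible d c &
        forall c d, A c -> A d -> forall x : M, cdom c x -> cdom d x ->
          0 < \det (jacobian (transition c d) (cmap c x))].

Section StandardDiffeology.
Variable M : manifold.

Definition manifold_plot n (U : set 'rV[R]_n) (p : 'rV[R]_n -> M) :=
  [/\ open U, forall r, U r -> {for r, continuous p} &
      forall c, atlas c -> smooth_on (U `&` p @^-1` cdom c) (cmap c \o p)].

Let manifold_plot_open n (U : set 'rV[R]_n) p : manifold_plot U p -> open U.
Proof. by case. Qed.

Let open_chart n (U : set 'rV[R]_n) (p : 'rV[R]_n -> M) (c : chart M (mdim M)) :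
  open U -> (forall r, U r -> {for r, continuous p}) ->
  open (U `&` p @^-1` cdom c).
Proof. by move=> oU cp; apply: open_preimage_in => //; exact: cdom_open. Qed.

Let manifold_plot_ext n (U : set 'rV[R]_n) p q :
  (forall r, U r -> p r = q r) -> manifold_plot U p -> manifold_plot U q.
Proof.
move=> pq [oU cp sp]; have cq r : U r -> {for r, continuous q}.
  move=> Ur; move: (cp r Ur); rewrite /prop_for /continuous_at (pq r Ur).
  have npq : \near r, p r = q r by apply: filterS pq _; apply: open_nbhs_nbhs.
  by apply: cvg_trans; exact: near_eq_cvg npq.
split=> // c Ac; have oUc := open_chart (c := c) oU cq.
apply: (smooth_on_ext oUc (f := cmap c \o p)) => [r [Ur _]|].
  by rewrite /= pq.
by apply: smooth_on_sub (sp c Ac) => r [Ur qr]; split=> //=; rewrite pq.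
Qed.

Let manifold_plot_cst n (U : set 'rV[R]_n) x :
  open U -> manifold_plot U (fun=> x).
Proof.
move=> oU; have cx r : U r -> {for r, continuous (fun=> x : M)}.
  by move=> _; exact: cst_continuous.
by split=> // c Ac k; apply: Ck_cst; exact: open_chart.
Qed.

Let manifold_plot_comp n m (U : set 'rV[R]_n) (V : set 'rV[R]_m) h p :
  open V -> smooth_on V h -> (forall r, V r -> U (h r)) ->
  manifold_plot U p -> manifold_plot V (p \o h).
Proof.
move=> oV sh hU [oU cp sp].
have cph r : V r -> {for r, continuous (p \o h)}.
  move=> Vr; apply: continuous_comp; first exact: (sh 0%N).
  by apply: cp; exact: hU.
split=> // c Ac; have oVc := open_chart (c := c) oV cph.
have sV : V `&` (p \o h) @^-1` cdom c `<=` V by move=> r [].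
rewrite compA; apply: (smooth_on_comp oVc _ (smooth_on_sub sV sh) (sp c Ac)).
by move=> r [Vr phr]; split=> //; exact: hU.
Qed.

Let manifold_plot_local n (U : set 'rV[R]_n) p : open U ->
  (forall r, U r -> exists V, [/\ open V, V r, V `<=` U & manifold_plot V p]) ->
  manifold_plot U p.
Proof.
move=> oU H; split=> // [r /H[V [_ Vr _ [_ cp _]]]|c Ac]; first exact: cp.
apply: smooth_on_local => r [/H[V [_ Vr _ [_ _ sp]]] pr].
by exists (V `&` p @^-1` cdom c) => //; exact: sp.
Qed.

Definition manifold_space : diffspace R := Diffspace
  (Diffeology manifold_plot_open manifold_plot_ext manifold_plot_cst
     manifold_plot_comp manifold_plot_local).

End StandardDiffeology.

(* A nowhere vanishing form of top degree n, given by its local expressions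
   vf c(x) dx^1 /\ ... /\ dx^n in the charts c of the atlas. *)
Record volume_form (M : manifold) := VolumeForm {
  vf :> chart M (mdim M) -> 'rV[R]_(mdim M) -> R ;
  vf_smooth : forall c, atlas c -> smooth_on (cmap c @` cdom c) (vf c) ;
  vf_change : forall c d, atlas c -> atlas d ->
    forall x, cdom c x -> cdom d x ->
    vf c (cmap c x) =
      \det (jacobian (transition c d) (cmap c x)) * vf d (cmap d x) ;
  vf_neq0 : forall c, atlas c -> forall x, cdom c x -> vf c (cmap c x) != 0
}.

Lemma measurable_tuple_cons n : measurable_fun [set: n.-tuple R * R]
  (fun z => [tuple of z.2 :: z.1] : n.+1.-tuple R).
Proof. exact: measurable_cons. Qed.

Definition lebesgue_tuple_step n (m : {measure set (n.-tuple R) -> \bar R}) :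
    {measure set (n.+1.-tuple R) -> \bar R} :=
  measure_function_pushforward__canonical__measure_function_Measure
    (m \x @lebesgue_measure R)%E (@measurable_tuple_cons n).

(* Lebesgue measure on R^n *)
Fixpoint lebesgue_tuple n : {measure set (n.-tuple R) -> \bar R} :=
  if n is n'.+1 then lebesgue_tuple_step (lebesgue_tuple n')
  else dirac [tuple].

Definition row_of_tuple n (t : n.-tuple R) : 'rV[R]_n := \row_i tnth t i.

Lemma ex_finite_atlas (M : closed_manifold) :
  exists s : seq (chart M (mdim M)), (forall c, List.In c s -> atlas c) /\
    (forall x : M, exists2 c, List.In c s & cdom c x).
Proof.
pose C (x : M) := sval (cid2 (atlas_cover x)).
have AC x : atlas (C x) by rewrite /C; case: cid2.
have xC x : cdom (C x) x by rewrite /C; case: cid2.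
have [[x0]|M0] := pselect (inhabited M); last first.
  by exists [::]; split=> // x; case: M0; exists.
pose pM : ptopologicalType := HB.pack (M : Type) (isPointed.Build M x0)
  (Topological.class M).
have cM : @compact pM setT := @cm_compact M.
rewrite compact_cover in cM.
have [|x _|D _ cD] := cM M setT (fun x => cdom (C x)).
- by move=> x _; exact: cdom_open.
- by exists x => //; exact: xC.
exists (map C (finmap.enum_fset D)); split=> [c /List.in_map_iff[x [<- _]]//|x].
have [y Dy Cyx] := cD x I; exists (C y) => //; apply: List.in_map.
have {}Dy : y \in finmap.enum_fset D by exact: Dy.
elim: (finmap.enum_fset D) Dy => // z s IH; rewrite inE => /orP[/eqP->|/IH ys].
  by left.
by right.
Qed.

(* A finite atlas, which exists by compactness *)
Definition finite_atlas (M : closed_manifold) : seq (chart M (mdim M)) :=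
  sval (cid (ex_finite_atlas M)).

Section Integral.
Variables (M : manifold) (vol : volume_form M).

(* The integral of f vol over the part outside A of the union of the charts in
   s: the part of each chart not covered by A and the previous charts is
   integrated in the coordinates of that chart. *)
Fixpoint charts_integral (f : M -> R) (A : set M)
    (s : seq (chart M (mdim M))) : \bar R :=
  (if s is c :: s' then
    \int[lebesgue_tuple (mdim M)]_(t in
        @row_of_tuple _ @^-1` (cmap c @` (cdom c `\` A)))
      (f (cinv c (row_of_tuple t)) * `|vol c (row_of_tuple t)|)%:E
    + charts_integral f (A `|` cdom c) s'
  else 0)%E.

End Integral.

(* The integral over M of f vol, for the orientation of M for which vol is
   positive: in a positively oriented chart `|vol c| is vol c. By the change of
   variables formula the value does not depend on the finite atlas. *)
Definition form_integral (M : closed_manifold) (vol : volume_form M)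
  (f : M -> R) : \bar R := charts_integral vol f set0 (finite_atlas M).

End Manifold.

(* Main.v *)
(* Suppose d(f0, f1) = 0. By the Cauchy-Schwarz inequality and Tonelli's theorem,
   the integral over a chart ball of the lengths of the paths ev_m \o gam is at
   most a constant times the length of gam, for every path gam from f0 to f1.
   Along paths whose lengths tend to 0, the infimum of the lengths of the
   ev_m \o gam has integral 0 over the ball, hence vanishes at some point m of
   it, and there f0 m = f1 m because d_N is a distance. So f0 and f1 agree on a
   dense set. Near a point m, choose m' with f0 m' = f1 m': the segment from m to
   m', mapped by f0, followed by the segment from m' back to m, mapped by f1, is
   a path from f0 m to f1 m whose length is at most a constant times the
   coordinate distance from m to m'. Hence d_N (f0 m, f1 m) = 0. *)
Require Import Defs.
From HB Require Import structures.
From mathcomp Require Import all_boot all_order all_algebra.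
From mathcomp Require Import all_classical all_reals all_analysis.
From mathcomp Require Import measurable_realfun ring lra.
Import numFieldNormedType.Exports.
Import Order.TTheory GRing.Theory Num.Theory.
Local Open Scope classical_set_scope.
Local Open Scope ring_scope.

Set Implicit Arguments. Unset Strict Implicit. Unset Printing Implicit Defensive.

(** * Tensors on plots: behaviour under morphisms, multilinearity and bounds *)

Lemma T2_class_eq (R : realType) (X : diffspace R) (a b : T2_pre X) :
  T2_step a b -> T2_class a = T2_class b.
Proof.
move=> ab; have eab : T2_eq a b by exact: Relation_Operators.rst_step.
apply: eq_exist; apply/seteqP; split=> c.
  by apply: Relation_Operators.rst_trans; exact: Relation_Operators.rst_sym.
exact: Relation_Operators.rst_trans.
Qed.

Lemma tensorE (R : realType) (X : diffspace R) (g : T2 X -> R) (P : plot X)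
    r v w (Pr : pdom P r) : tensor g P r v w = g (T2_class (T2Pre v w Pr)).
Proof.
rewrite /tensor; case: pselect => // Pr'; congr (g (T2_class (T2Pre v w _))).
exact: Prop_irrelevance.
Qed.

(** A plot carries the proof that it is one; this identifies tensors when the same map has been
    shown to be a plot in two ways. *)
Lemma tensor_irrelevance (R : realType) (X : diffspace R) (g : T2 X -> R) n
    (U : set 'rV[R]_n) (p : 'rV[R]_n -> X) (p1 p2 : is_plot X U p) r v w :
  tensor g (Plot p1) r v w = tensor g (Plot p2) r v w.
Proof. by rewrite (Prop_irrelevance p1 p2). Qed.

(** The colimit identifies [(r, v, w)] with its image under a morphism of plots, and the jacobian
    applied to [v] is the directional derivative along [v]. Every comparison of tensors on different
    plots rests on this. *)
Lemma tensor_comp (R : realType) (X : diffspace R) (g : T2 X -> R)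
    (P Q : plot X) (h : 'rV[R]_(pdim P) -> 'rV[R]_(pdim Q)) r v w :
  smooth_on (pdom P) h -> (forall s, pdom P s -> pdom Q (h s)) ->
  (forall s, pdom P s -> Defs.pmap Q (h s) = Defs.pmap P s) -> pdom P r ->
  tensor g P r v w = tensor g Q (h r) ('D_v h r) ('D_w h r).
Proof.
move=> sh hQ hE Pr; rewrite (tensorE _ _ _ Pr) (tensorE _ _ _ (hQ r Pr)).
congr g; apply: T2_class_eq.
have [dh _] := sh 1%N.
by exists h; split=> //=; split=> //; apply: deriveEjacobian; exact: dh.
Qed.

Lemma tensor_lin_sum (R : realType) (X : diffspace R) (g : weak_riemannian X)
    (P : plot X) r v w : pdom P r ->
  tensor g P r v w = \sum_i v ord0 i * tensor g P r (delta_mx ord0 i) w.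
Proof.
move=> Pr.
(* Linearity applied to [-1 *: 0 + 0]. *)
have T0 : tensor g P r 0 w = 0.
  by have := wr_lin g (-1) 0 0 w Pr; rewrite scaler0 addr0 mulN1r addNr.
rewrite [in LHS](row_sum_delta v); elim/big_rec2: _ => // i x y _ <-.
by rewrite wr_lin.
Qed.

(** Expanding both arguments in the standard basis gives [pdim P] squared terms, each at most [|v|]
    squared times [B]. *)
Lemma tensor_bound (R : realType) (X : diffspace R) (g : weak_riemannian X)
    (P : plot X) r v (B : R) : pdom P r ->
  (forall i j, `|tensor g P r (delta_mx ord0 i) (delta_mx ord0 j)| <= B) ->
  tensor g P r v v <= (`|v| * (pdim P)%:R) ^+ 2 * B.
Proof.
move=> Pr TB; apply: (le_trans (ler_norm _)).
have vi i : `|v ord0 i| <= `|v|.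
  by rewrite [leRHS]mx_normrE; apply: (le_bigmax _ (fun k => `|v k.1 k.2|) (ord0, i)).
rewrite tensor_lin_sum//; apply: (le_trans (ler_norm_sum _ _ _)).
have S (x : R) : \sum_(i < pdim P) x = (pdim P)%:R * x.
  by rewrite sumr_const card_ord mulr_natl.
rewrite exprMn expr2 [X in _ <= X](_ : _ =
  (pdim P)%:R * (`|v| * ((pdim P)%:R * (`|v| * B)))); last first.
  by rewrite !expr2; ring.
rewrite -S; apply: ler_sum => i _; rewrite normrM; apply: ler_pM => //.
rewrite wr_sym// tensor_lin_sum//; apply: (le_trans (ler_norm_sum _ _ _)).
rewrite -S; apply: ler_sum => j _; rewrite normrM; apply: ler_pM => //.
Qed.

Lemma tensorZ (R : realType) (X : diffspace R) (g : weak_riemannian X)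
    (P : plot X) r a v : pdom P r ->
  tensor g P r (a *: v) (a *: v) = a ^+ 2 * tensor g P r v v.
Proof.
have Z x y w : pdom P r -> tensor g P r (x *: y) w = x * tensor g P r y w.
  by move=> Pr; rewrite !(@tensor_lin_sum _ _ _ _ _ _ w Pr) mulr_sumr;
    apply: eq_bigr => i _; rewrite !mxE mulrA.
by move=> Pr; rewrite Z// wr_sym// Z// expr2 mulrA.
Qed.

(** * Measurability and Lebesgue measure on R^n, with points encoded as tuples *)

Lemma measurable_row_of_tuple_ball (R : realType) n (x : 'rV[R]_n) (e : R) :
  measurable (row_of_tuple (n := n) @^-1` ball x e).
Proof.
(* A ball of nonpositive radius is empty, also in dimension 0, where the intersection over the
   coordinates used below would be everything. *)
have [e0|e0] := ltP 0 e; last first.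
  rewrite (_ : _ @^-1` _ = set0)//; apply/seteqP; split=> // t [].
  by rewrite ltNge e0.
rewrite (_ : _ @^-1` _ =
    \bigcap_(i : 'I_n) ((@tnth n R ^~ i) @^-1` ball (x ord0 i) e)).
  apply: fin_bigcap_measurable => // i _; rewrite -[X in measurable X]setTI.
  by apply: measurable_tnth => //; exact: measurable_ball.
apply/seteqP; split=> t.
  by move=> [_ xt] i _ /=; have := xt ord0 i; rewrite mxE.
by move=> xt; split=> // i j; rewrite mxE ord1; exact: xt.
Qed.

(** Balls with rational centres and radii [1/(k+1)] form a countable base. It transfers
    measurability from balls to open sets, since the tuples carry the product sigma-algebra. Balls
    not contained in [O] are replaced by the empty set to keep a fixed countable index type. *)
Lemma open_bigcup_ball_rat (R : realType) n (O : set 'rV[R]_n) : open O ->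
  O = \bigcup_(qk : 'rV[rat]_n * nat)
    (if `[< ball (map_mx (@ratr R) qk.1) (qk.2.+1%:R^-1) `<=` O >]
     then ball (map_mx (@ratr R) qk.1) (qk.2.+1%:R^-1) else set0).
Proof.
move=> oO; apply/seteqP; split=> [x Ox|x [[q k] _]]; last first.
  by case: asboolP => // qO; exact: qO.
have /nbhs_ballP[e /= e0 xO] := open_nbhs_nbhs (conj oO Ox).
(* Half of [e], because two points of one ball of radius [1/(k+1)] are only known to be within twice
   that radius. *)
have [k ke] : exists k : nat, k.+1%:R^-1 < e / 2.
  have [k _ H] := near_infty_natSinv_lt (PosNum (divr_gt0 e0 (@ltr0Sn R 1))).
  by exists k; exact: H k (leqnn k).
have Q i : exists q : rat, ratr q \in `](x ord0 i - k.+1%:R^-1), (x ord0 i + k.+1%:R^-1)[.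
  by apply: rat_in_itvoo; rewrite ltrBlDr -addrA ltrDl addr_gt0// invr_gt0 ltr0Sn.
pose q : 'rV[rat]_n := \row_i sval (cid (Q i)).
have qx : ball (map_mx (@ratr R) q) (k.+1%:R^-1) x.
  split=> [|i j]; first by rewrite invr_gt0 ltr0Sn.
  rewrite !ord1 !mxE; case: cid => r /=; rewrite in_itv/= => /andP[r1 r2].
  by rewrite /ball/= ltr_distlC ltrBlDr r2 -ltrBlDr r1.
exists (q, k) => //=; case: asboolP => // -[] y qy; apply: xO.
apply: (@le_ball _ _ x (k.+1%:R^-1 + k.+1%:R^-1)).
  by rewrite [leRHS]splitr lerD// ltW.
exact: ball_triangle (ball_sym qx) qy.
Qed.

Lemma measurable_row_of_tuple_open (R : realType) n (O : set 'rV[R]_n) :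
  open O -> measurable (row_of_tuple (n := n) @^-1` O).
Proof.
move=> oO; rewrite (open_bigcup_ball_rat oO) preimage_bigcup.
apply: countable_bigcupT_measurable => [|[q k]]; first exact: countableP.
by case: ifP => _; [exact: measurable_row_of_tuple_ball|rewrite preimage_set0].
Qed.

Lemma measurable_fun_row_of_tuple (R : realType) n (U : set 'rV[R]_n)
    (f : 'rV[R]_n -> R) : open U -> (forall x, U x -> {for x, continuous f}) ->
  measurable_fun (row_of_tuple (n := n) @^-1` U) (f \o row_of_tuple (n := n)).
Proof.
move=> oU cf; apply: (measurability _ (RGenOpens.measurableE R)).
move=> _ [_ [a [b ->]] <-].
apply: (@measurable_row_of_tuple_open _ _ (U `&` f @^-1` `]a, b[)).
by apply: open_preimage_in => //; exact: interval_open.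
Qed.

(** By induction on [n]: for the sup norm, a ball in dimension [n.+1] is the product of a ball in
    dimension [n] and an interval of length [2 e]. In dimension 0 the measure is the Dirac mass at
    the only point. *)
Lemma lebesgue_tuple_ball (R : realType) n (x : 'rV[R]_n) (e : R) : 0 < e ->
  lebesgue_tuple R n (row_of_tuple (n := n) @^-1` ball x e) = ((e *+ 2) ^+ n)%:E.
Proof.
move=> e0; elim: n x => [|n IH] x.
  rewrite /= diracE mem_set//; split=> // i [].
  by [].
pose x' : 'rV[R]_n := \row_i x ord0 (lift ord0 i).
rewrite exprS mulrC EFinM -(IH x') -(lebesgue_measure_ball (x ord0 ord0)) ?ltW//.
rewrite -product_measure1E; [|exact: measurable_row_of_tuple_ball|exact: measurable_ball].
rewrite /= /pushforward; congr (product_measure1 _ _ _).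
apply/seteqP; split=> -[t s] /=.
  move=> [_ xts]; split=> /=.
    split=> // i j; have := xts ord0 (lift ord0 j).
    by rewrite !mxE !tnthS.
  by have := xts ord0 ord0; rewrite mxE.
move=> [[_ xt] xs]; split=> // i j; rewrite ord1 mxE.
case: (unliftP ord0 j) => [k ->|->//].
by have := xt ord0 k; rewrite tnthS !mxE.
Qed.

(** * Smooth maps into R^n, and plots coming from charts and from the functional diffeology *)

Lemma derive_affine (R : realType) (V W : normedModType R) (f : V -> W) x v w :
  (forall s, f (s *: v + x) = s *: w + f x) -> 'D_v f x = w.
Proof.
move=> fE; apply/cvg_lim => //.
apply: cvg_near_cst; near=> s.
rewrite /= fE addrK scalerA mulVf ?scale1r//.
by near: s; exact: nbhs_dnbhs_neq.
Unshelve. all: by end_near. Qed.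

Lemma smooth_on_row (R : realType) m n (U : set 'rV[R]_m)
    (f : 'rV[R]_m -> 'rV[R]_n) : open U ->
  (forall i, smooth_on U (fun x => f x ord0 i : R)) -> smooth_on U f.
Proof.
move=> oU sf k.
have -> : f = \sum_i (fun x => f x ord0 i *: delta_mx ord0 i).
  by apply/funext => x; rewrite fct_sumE [LHS]row_sum_delta.
apply: Ck_sum => // i; apply: Ck_scale => //; first exact: sf.
exact: Ck_cst.
Qed.

Lemma smooth_on_coord (R : realType) m (U : set 'rV[R]_m) i :
  open U -> smooth_on U (fun x => x ord0 i : R).
Proof. by move=> oU k; apply: (Ck_coord (f := id)) => //; exact: Ck_id. Qed.

Lemma chart_plot (R : realType) (M : manifold R) (c : chart R M (mdim M)) :
  atlas c -> is_plot (manifold_space M) (cmap c @` cdom c) (cinv c).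
Proof.
move=> Ac; split=> [|u cu|d Ad]; first exact: cimage_open.
  exact: cinv_cont.
apply: smooth_on_sub (atlas_compatible Ac Ad) => u [[x cx <-]] /=.
by rewrite cmapK// => dx; exists x.
Qed.

Lemma adjoint_plot (R : realType) (X Y : diffspace R) n (U : set 'rV[R]_n)
    m (V : set 'rV[R]_m)
    (p : 'rV[R]_n -> func_space X Y) (h : 'rV[R]_m -> 'rV[R]_n) (q : 'rV[R]_m -> X) :
  is_plot (func_space X Y) U p -> smooth_on V h -> (forall r, V r -> U (h r)) ->
  is_plot X V q -> is_plot Y V (fun r => sval (p (h r)) (q r)).
Proof.
move=> [oU sp] sh hU qP; have oV := plot_open qP.
have [->|/set0P[r0 Vr0]] := eqVneq V set0.
  by apply: plot_local => //; exact: open0.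
(* Outside [V] the value is a dummy point of [U]; only the values on [V] matter. *)
pose z (r : 'rV[R]_m) : prod_space (domain_space U) X :=
  (if pselect (V r) is left Vr then exist _ _ (hU _ Vr)
   else exist _ _ (hU _ Vr0), q r).
have zE r : V r -> sval (z r).1 = h r by rewrite /z /=; case: pselect.
have zP : is_plot (prod_space (domain_space U) X) V z.
  by split=> //; split=> //; apply: smooth_on_ext sh => // r Vr; rewrite zE.
by apply: plot_ext (sp _ _ _ zP) => r Vr; rewrite /= /adjoint zE.
Qed.

(** * A path of maps read in a chart, as one plot in time and space *)

Section RowCons.
Variables (R : realType) (n : nat).

Definition row_behead (r : 'rV[R]_n.+1) : 'rV[R]_n :=
  \row_i r ord0 (lift ord0 i).

Definition row_cons (t : R) (u : 'rV[R]_n) : 'rV[R]_n.+1 :=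
  \row_i (if unlift ord0 i is Some j then u ord0 j else t).

Lemma row_behead_cons t u : row_behead (row_cons t u) = u.
Proof. by apply/rowP => i; rewrite !mxE liftK. Qed.

Lemma row_cons_head t u : row_cons t u ord0 ord0 = t.
Proof. by rewrite mxE unlift_none. Qed.

Lemma row_behead_smooth : smooth_on setT row_behead.
Proof.
apply: smooth_on_row => [|i]; first exact: openT.
under eq_fun do rewrite mxE.
exact/smooth_on_coord/openT.
Qed.

End RowCons.

Section PathChart.
Variables (R : realType) (M : manifold R) (N : diffspace R).
Variables (f0 f1 : func_space (manifold_space M) N) (gam : Defs.path f0 f1).
Variables (c : chart R M (mdim M)) (Ac : atlas c).
Let n := mdim M.

Let U := [set r | (cmap c @` cdom c) (row_behead r)].

Lemma chart_domain_open : open U.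
Proof.
rewrite -[U]setTI; apply: open_preimage_in; first exact: openT.
  by move=> r _; apply: (@row_behead_smooth R n 0%N).
exact: cimage_open.
Qed.

(** Coordinate 0 is time and the others are chart coordinates. Having one plot in both makes the
    squared speed of [ev_m \o gam] smooth jointly in time and [m], as Tonelli's theorem will
    require. *)
Lemma path_chart_plotP : is_plot N U
  (fun r => sval (gam (r ord0 ord0)) (cinv c (row_behead r))).
Proof.
pose h (r : 'rV[R]_n.+1) : 'rV[R]_1 := const_mx (r ord0 ord0).
have sh : smooth_on U h.
  apply: smooth_on_row => [|i]; first exact: chart_domain_open.
  under eq_fun do rewrite mxE.
  exact/smooth_on_coord/chart_domain_open.
have tP : is_plot (manifold_space M) U (cinv c \o @row_behead R n).
  apply: plot_comp (chart_plot Ac) => //; first exact: chart_domain_open.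
  by apply: smooth_on_sub (@row_behead_smooth R n).
have /= := adjoint_plot (path_smooth gam) sh (fun _ _ => I) tP.
by apply: plot_ext => r _; rewrite /h mxE.
Qed.

Definition path_chart_plot : plot N := Plot path_chart_plotP.

(** For fixed [u], the map sending [s] to [(s, u)] is a morphism from the evaluated path to the
    joint plot, and its derivative is the time basis vector. *)
Lemma tensor_path_chart (g : T2 N -> R) (t : R) u : (cmap c @` cdom c) u ->
  tensor g (plot_map (ev_smooth (manifold_space M) N (cinv c u)) (path_plot gam))
    (const_mx t) (const_mx 1) (const_mx 1) =
  tensor g path_chart_plot (row_cons t u) (delta_mx ord0 ord0) (delta_mx ord0 ord0).
Proof.
move=> cu.
pose h (s : 'rV[R]_1) := row_cons (s ord0 ord0) u.
rewrite (@tensor_comp _ _ g (plot_map (ev_smooth (manifold_space M) N (cinv c u))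
  (path_plot gam)) path_chart_plot h)//=.
- rewrite [h _]/h mxE; congr tensor.
    apply: derive_affine => s; apply/rowP => i; rewrite !mxE.
    by case: unliftP => [j ->|->]; rewrite ?mxE/=; ring.
  apply: derive_affine => s; apply/rowP => i; rewrite !mxE.
  by case: unliftP => [j ->|->]; rewrite ?mxE/=; ring.
- apply: smooth_on_row => [|i]; first exact: openT.
  case: (unliftP ord0 i) => [j ->|->].
    rewrite (_ : (fun _ => _) = cst (u ord0 j)).
      by move=> k; apply: Ck_cst; exact: openT.
    by apply/funext => x; rewrite mxE liftK.
  rewrite (_ : (fun _ => _) = fun x : 'rV[R]_1 => x ord0 ord0).
    exact/smooth_on_coord/openT.
  by apply/funext => x; rewrite row_cons_head.
- by move=> s _; rewrite /U /= /h row_behead_cons.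
by move=> s _; rewrite /h row_behead_cons row_cons_head.
Qed.

End PathChart.

(* Instead of Cauchy-Schwarz, integrate [b <= b^2 / (2 l) + l / 2] with
   [l = sqrt s]. *)
Lemma integral_le_sqrt_integral_sq d (T : measurableType d) (R : realType)
    (mu : {measure set T -> \bar R}) (K : set T) (k ka s : R) (b : T -> R) :
  measurable K -> mu K = k%:E -> measurable_fun K b -> (forall x, 0 <= b x) ->
  0 < ka -> 0 <= s ->
  (ka%:E * \int[mu]_(x in K) (b x ^+ 2)%:E <= s%:E)%E ->
  (\int[mu]_(x in K) (b x)%:E <= ((ka^-1 + k) / 2 * Num.sqrt s)%:E)%E.
Proof.
move=> mK muK mb b0 ka0 s0 bs.
have k0 : 0 <= k by rewrite -lee_fin -muK.
have mb2 : measurable_fun K (fun x => (b x ^+ 2)%:E).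
  by apply/measurable_EFinP; exact: measurable_funX.
have Ib2 : (\int[mu]_(x in K) (b x ^+ 2)%:E <= (s / ka)%:E)%E.
  by rewrite EFinM muleC lee_pdivlMl.
have H l : 0 < l ->
    (\int[mu]_(x in K) (b x)%:E <= ((2 * l)^-1 * (s / ka) + l / 2 * k)%:E)%E.
  move=> l0.
  apply: (@le_trans _ _ (\int[mu]_(x in K)
      (((2 * l)^-1)%:E * (b x ^+ 2)%:E + (l / 2)%:E))%E).
    apply: ge0_le_integral => //.
    - by move=> x _; rewrite lee_fin.
    - exact/measurable_EFinP.
    - by apply: emeasurable_funD => //; exact: measurable_funeM.
    move=> x _; rewrite -EFinM -EFinD lee_fin -subr_ge0.
    (* The difference of the two sides is a multiple of a perfect square. *)
    rewrite [leRHS](_ : _ = (2 * l)^-1 * (b x - l) ^+ 2); last by field; exact: lt0r_neq0.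
    by rewrite mulr_ge0 ?sqr_ge0// invr_ge0 mulr_ge0 ?ltW.
  rewrite ge0_integralD//; last 3 first.
  - by move=> x _; rewrite mule_ge0// lee_fin ?sqr_ge0// invr_ge0 mulr_ge0 ?ltW.
  - exact: measurable_funeM.
  - by move=> x _; rewrite lee_fin divr_ge0 ?ltW.
  rewrite ge0_integralZl//; last 2 first.
  - by move=> x _; rewrite lee_fin sqr_ge0.
  - by rewrite lee_fin invr_ge0 mulr_ge0 ?ltW.
  rewrite (integral_cst mu mK (l / 2)%:E) muK EFinD !EFinM; apply: leeD => //.
  by rewrite lee_wpmul2l// lee_fin invr_ge0 mulr_ge0 ?ltW.
have [s_gt0|] := ltP 0 s.
  apply: le_trans (H (Num.sqrt s) _) _; first by rewrite sqrtr_gt0.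
  rewrite lee_fin -{2}(sqr_sqrtr s0) le_eqVlt; apply/orP; left; apply/eqP.
  by field; rewrite lt0r_neq0//= lt0r_neq0// sqrtr_gt0.
rewrite le_eqVlt ltNge s0 orbF => /eqP s_0.
(* For [s = 0] the choice [l = sqrt s] is not positive; a small [l] is taken instead, for which the
   bound is [e * (k / (k + 1))]. *)
apply/lee_addgt0Pr => e e0; rewrite s_0 sqrtr0 mulr0 add0e.
apply: le_trans (H (2 * (e / (k + 1))) _) _.
  by rewrite mulr_gt0// divr_gt0// ltr_wpDl.
rewrite lee_fin s_0 mul0r mulr0 add0r [leLHS](_ : _ = e * (k / (k + 1))).
  by rewrite ger_pMr// ler_pdivrMr ?ltr_wpDl// mul1r lerDl.
by field; rewrite lt0r_neq0// ltr_wpDl.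
Qed.

(** * Bounding the integral over the manifold from below by an integral over a chart ball *)

Section ChartsIntegral.
Variables (R : realType) (M : manifold R) (vol : volume_form M).
Let n := mdim M.
Let row := @row_of_tuple R n.

(** The manifold is given no sigma-algebra, so measurability is required of the expressions in
    charts. *)
Definition chart_measurable (f : M -> R) := forall c, atlas c ->
  measurable_fun (row @^-1` (cmap c @` cdom c)) (f \o cinv c \o row).

Lemma vf_continuous (c : chart R M n) u : atlas c -> (cmap c @` cdom c) u ->
  {for u, continuous (vol c)}.
Proof. by move=> Ac cu; exact: (vf_smooth vol Ac 0%N). Qed.

Lemma charts_integral_ge0 (f : M -> R) A s : (forall m, 0 <= f m) ->
  (0 <= charts_integral vol f A s)%E.
Proof.
move=> f0; elim: s A => //= c s IH A; apply: adde_ge0 => //.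
by apply: integral_ge0 => t _; rewrite lee_fin mulr_ge0.
Qed.

(** For open [A] this presents the domain of integration in [charts_integral] as a difference of two
    open sets, hence as measurable. *)
Lemma chart_image_setD (c : chart R M n) (A : set M) :
  cmap c @` (cdom c `\` A) =
  (cmap c @` cdom c) `\` ((cmap c @` cdom c) `&` cinv c @^-1` A).
Proof.
apply/seteqP; split=> [_ [x [cx Ax] <-]|_ [[x cx <-] Ax]].
  by split; [exists x|rewrite /= cmapK// => -[]].
by exists x => //; split=> // Ax'; apply: Ax; split; [exists x|rewrite /= cmapK].
Qed.

Lemma chart_image_setI_open (c : chart R M n) (A : set M) : open A ->
  open ((cmap c @` cdom c) `&` cinv c @^-1` A).
Proof.
move=> oA; apply: open_preimage_in => //; first exact: cimage_open.
exact: cinv_cont.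
Qed.

(* The first chart of the list meeting [W] is integrated over all of its
   intersection with [W]. *)
Lemma charts_integral_chart (W A : set M) (s : seq (chart R M n)) :
  W !=set0 -> open A -> W `&` A = set0 ->
  (forall c, List.In c s -> atlas c) ->
  (forall x, W x -> exists2 c, List.In c s & cdom c x) ->
  exists c x, [/\ atlas c, W x, cdom c x &
    forall f K, (forall m, 0 <= f m) -> chart_measurable f ->
      K `<=` cmap c @` (cdom c `&` W) -> measurable (row @^-1` K) ->
      (\int[lebesgue_tuple R n]_(t in row @^-1` K)
         (f (cinv c (row t)) * `|vol c (row t)|)%:E
       <= charts_integral vol f A s)%E].
Proof.
move=> [x0 Wx0]; elim: s A => [A _ _ _ /(_ _ Wx0)[]//|c s IH A oA WA sA sW].
have Ac : atlas c by apply: sA; left.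
have [[x [cx Wx]]|cW0] := pselect (exists x, cdom c x /\ W x).
  exists c, x; split=> // f K f0 mf KW mK /=.
  apply: le_trans (leeDl _ (charts_integral_ge0 _ _ f0)).
  apply: ge0_subset_integral => //.
  - rewrite chart_image_setD; set I := cmap c @` cdom c.
    apply: (@measurableD _ _ (row @^-1` I) (row @^-1` (I `&` cinv c @^-1` A))).
      by apply: measurable_row_of_tuple_open; exact: cimage_open.
    by apply: measurable_row_of_tuple_open; exact: chart_image_setI_open.
  - apply: (@measurable_funS _ _ _ _ (row @^-1` (cmap c @` cdom c))).
    + by apply: measurable_row_of_tuple_open; exact: cimage_open.
    + by move=> t [y [cy _] yt]; exists y.
    apply/measurable_EFinP; apply: measurable_funM; first exact: mf.
    apply: (measurable_fun_row_of_tuple (f := fun u => `|vol c u|)).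
      exact: cimage_open.
    move=> u cu; apply: continuous_comp; first exact: vf_continuous.
    exact: norm_continuous.
  - by move=> t _; rewrite lee_fin mulr_ge0.
  (* Removing [A] loses no point of [W], as the two are disjoint. *)
  move=> t /KW[y [cy Wy] yt]; exists y => //; split=> // Ay.
  by have : set0 y by rewrite -WA.
(* The chart [c] misses [W], so enlarging [A] by its domain keeps it disjoint from [W] and the
   induction goes on. *)
have [||||d [x [Ad Wx dx H]]] := IH (A `|` cdom c).
- by apply: openU => //; exact: cdom_open.
- rewrite setIUr WA set0U; apply/seteqP; split=> // y [Wy cy].
  by apply: cW0; exists y.
- by move=> d ds; apply: sA; right.
- move=> x Wx; have [d [<- cx|ds dx]] := sW _ Wx; last by exists d.
  by case: cW0; exists x.
- exists d, x; split=> // f K f0 mf KW mK.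
  apply: le_trans (H _ _ f0 mf KW mK) _ => /=.
  by apply: leeDr; apply: integral_ge0 => t _; rewrite lee_fin mulr_ge0.
Qed.

End ChartsIntegral.

(** In the first chart of the finite atlas meeting [W], the density of the volume form is continuous
    and nonzero, so its absolute value stays above some [k > 0] on a small ball mapped into [W]. The
    ball and [k] are chosen before [f]: the same ones serve all times and all paths. *)
Lemma form_integral_chart (R : realType) (M : closed_manifold R)
    (vol : volume_form M) (W : set M) : open W -> W !=set0 ->
  exists (c : chart R M (mdim M)) u (e k : R),
    [/\ atlas c, 0 < e, 0 < k,
        ball u e `<=` (cmap c @` cdom c) `&` cinv c @^-1` W &
    forall f, (forall m, 0 <= f m) -> chart_measurable f ->
      (k%:E * \int[lebesgue_tuple R (mdim M)]_(t in
           row_of_tuple (n := mdim M) @^-1` ball u e)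
         (f (cinv c (row_of_tuple t)))%:E
       <= form_integral vol f)%E].
Proof.
move=> oW W0; rewrite /form_integral /finite_atlas; case: cid => s /= [sA sM].
have [|c [x [Ac Wx cx H]]] :=
  @charts_integral_chart _ _ vol W set0 s W0 open0 (setI0 _) sA.
  by move=> y _; exact: sM.
pose u := cmap c x; have cu : (cmap c @` cdom c) u by exists x.
(* Half of the density at [u], a strict lower bound that persists near [u]. *)
have [k k0 ku] : exists2 k, 0 < k & k < `|vol c u|.
  exists (`|vol c u| / 2).
    by rewrite divr_gt0// normr_gt0; exact: vf_neq0.
  by rewrite ltr_pdivrMr// ltr_pMr ?ltr1n// normr_gt0; exact: vf_neq0.
have : nbhs u (((cmap c @` cdom c) `&` cinv c @^-1` W) `&` [set y | k < `|vol c y|]).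
  apply: filterI.
    apply: open_nbhs_nbhs; split; first exact: chart_image_setI_open.
    by split=> //=; rewrite /u cmapK.
  have cv : {for u, continuous (fun y => `|vol c y|)}.
    apply: continuous_comp; first exact: vf_continuous.
    exact: norm_continuous.
  by apply: (cvgr_gt _ cv); exact: ku.
move=> /nbhs_ballP[e /= e0 ue]; exists c, u, e, k; split=> //.
  by move=> y /ue[].
move=> f f0 mf; have mB := measurable_row_of_tuple_ball u e.
have mfB : measurable_fun (row_of_tuple (n := mdim M) @^-1` ball u e)
    (fun t => f (cinv c (row_of_tuple t))).
  apply: measurable_funS (mf c Ac) => [|t /ue[[]//]].
  by apply: measurable_row_of_tuple_open; exact: cimage_open.
rewrite -ge0_integralZl//; last 3 first.
- exact/measurable_EFinP.
- by move=> t _; rewrite lee_fin.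
- by rewrite lee_fin ltW.
apply: le_trans (H f (ball u e) f0 mf _ mB); last first.
  move=> y /ue[[[z cz <-] Wz] _]; exists z => //; split=> //.
  by rewrite /= cmapK in Wz.
apply: ge0_le_integral => //.
- by move=> t _; rewrite -EFinM lee_fin mulr_ge0// ltW.
- by apply: measurable_funeM; exact/measurable_EFinP.
- apply/measurable_EFinP; apply: measurable_funM => //.
  apply: (measurable_fun_row_of_tuple (f := fun u => `|vol c u|)).
    exact: ball_open.
  move=> y /ue[[cy _] _]; apply: continuous_comp; first exact: vf_continuous.
  exact: norm_continuous.
by move=> t /ue[_ kt]; rewrite -EFinM lee_fin mulrC; apply: ler_wpM2l => //; exact: ltW.
Qed.

(** * Lengths of the evaluated paths and their integral over a chart ball *)

Lemma const_mx_continuous (R : realType) m n :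
  continuous (fun t : R => const_mx t : 'M[R]_(m.+1, n.+1)).
Proof.
move=> t; apply/cvg_ballP => e e0; near=> s.
split=> // i j; rewrite !mxE; near: s.
exact: (nbhsx_ballx t e e0).
Unshelve. all: by end_near. Qed.

Lemma tensor_continuous (R : realType) (X : diffspace R) (g : weak_riemannian X)
    (P : plot X) v w r : pdom P r ->
  {for r, continuous (fun s => tensor g P s v w)}.
Proof. exact: (wr_smooth g (P := P) v w 0%N). Qed.

Lemma path_speed_measurable (R : realType) (X : diffspace R)
    (g : weak_riemannian X) (x y : X) (c : Defs.path x y) (D : set R) :
  measurable_fun D (fun t => Num.sqrt (tensor g (path_plot c) (const_mx t)
    (const_mx 1) (const_mx 1))).
Proof.
apply: (measurable_funS measurableT) => //.
apply: continuous_measurable_fun => t.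
apply: continuous_comp; last exact: sqrt_continuous.
apply: (continuous_comp (f := fun t : R => const_mx t : 'rV[R]_1)
  (g := fun s => tensor g (path_plot c) s (const_mx 1) (const_mx 1))).
  exact: const_mx_continuous.
exact: tensor_continuous.
Qed.

Lemma row_of_tuple_cons (R : realType) n (t : R) (u : n.-tuple R) :
  row_of_tuple [tuple of t :: u] = row_cons t (row_of_tuple u).
Proof.
apply/rowP => i; rewrite !mxE.
by case: unliftP => [j ->|->//]; rewrite tnthS mxE.
Qed.

Section PathFunctionSpace.
Variables (R : realType) (M : manifold R) (N : diffspace R).
Variables (gN : weak_riemannian N).
Variables (f0 f1 : func_space (manifold_space M) N) (gam : Defs.path f0 f1).

Lemma ev_path_plot (m : M) :
  is_plot N setT (fun t : 'rV[R]_1 => sval (gam (t ord0 ord0)) m).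
Proof. exact: (ev_smooth (manifold_space M) N m _ _ _ (path_smooth gam)). Qed.

Lemma ev_path0 (m : M) : sval (gam 0) m = sval f0 m.
Proof. by rewrite path0. Qed.

Lemma ev_path1 (m : M) : sval (gam 1) m = sval f1 m.
Proof. by rewrite path1. Qed.

Definition ev_path (m : M) : Defs.path (sval f0 m : N) (sval f1 m) :=
  Path (path_fun := fun t => sval (gam t) m : N)
    (ev_path_plot m) (ev_path0 m) (ev_path1 m).

(** The squared speed of [ev_path m] at time [t], written with [plot_map] so as to be the integrand
    defining the metric on the function space. *)
Definition ev_tensor (t : R) (m : M) : R :=
  tensor gN (plot_map (ev_smooth (manifold_space M) N m) (path_plot gam))
    (const_mx t) (const_mx 1) (const_mx 1).

Lemma ev_path_length (m : M) : path_length gN (ev_path m) =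
  (\int[@lebesgue_measure R]_(t in `[0%R, 1%R]) (Num.sqrt (ev_tensor t m))%:E)%E.
Proof.
apply: eq_integral => t _; congr (Num.sqrt _)%:E.
exact: tensor_irrelevance.
Qed.

Lemma ev_tensor_ge0 t m : 0 <= ev_tensor t m.
Proof. exact: wr_ge0. Qed.

Lemma ev_tensor_chart (c : chart R M (mdim M)) (Ac : atlas c) t u :
  (cmap c @` cdom c) u -> ev_tensor t (cinv c u) =
  tensor gN (path_chart_plot gam Ac) (row_cons t u)
    (delta_mx ord0 ord0) (delta_mx ord0 ord0).
Proof. by move=> cu; exact: tensor_path_chart. Qed.

Lemma ev_tensor_measurable t : chart_measurable (ev_tensor t).
Proof.
move=> c Ac.
pose b (r : 'rV[R]_(mdim M).+1) := tensor gN (path_chart_plot gam Ac) r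
  (delta_mx ord0 ord0) (delta_mx ord0 ord0).
apply: (measurable_fun_row_of_tuple (f := ev_tensor t \o cinv c)).
  exact: cimage_open.
move=> u cu.
have sm : smooth_on (cmap c @` cdom c) (ev_tensor t \o cinv c).
  have oc : open (cmap c @` cdom c) by exact: cimage_open.
  have bE v : (cmap c @` cdom c) v -> (b \o row_cons t) v = (ev_tensor t \o cinv c) v.
    by move=> cv; rewrite /= (ev_tensor_chart Ac).
  apply: (smooth_on_ext oc bE).
  apply: (@smooth_on_comp _ _ _ _ _ (pdom (path_chart_plot gam Ac)) _ _ oc).
  - by move=> v cv /=; rewrite row_behead_cons.
  - apply: smooth_on_row => [|i]; first exact: cimage_open.
    case: (unliftP ord0 i) => [j ->|->].
      rewrite (_ : (fun _ => _) = fun x : 'rV[R]_(mdim M) => x ord0 j).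
        exact/smooth_on_coord/cimage_open.
      by apply/funext => x; rewrite mxE liftK.
    rewrite (_ : (fun _ => _) = cst t).
      by move=> k; apply: Ck_cst; exact: cimage_open.
    by apply/funext => x; rewrite row_cons_head.
  - exact: wr_smooth.
exact: (sm 0%N).
Qed.

Variables (g : weak_riemannian (func_space (manifold_space M) N)).
Variables (c : chart R M (mdim M)) (Ac : atlas c).
Variables (u0 : 'rV[R]_(mdim M)) (e k : R).
Hypotheses (e0 : 0 < e) (k0 : 0 < k) (u0c : ball u0 e `<=` cmap c @` cdom c).
Let n := mdim M.
Let row := @row_of_tuple R n.
Let B := row @^-1` ball u0 e.
(** The comparison that [form_integral_chart] supplies, once the metric on the function space is the
    integral of [ev_tensor]. *)
Hypothesis Hk : forall t, (k%:E * \int[lebesgue_tuple R n]_(x in B)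
  (ev_tensor t (cinv c (row x)))%:E <=
  (tensor g (path_plot gam) (const_mx t) (const_mx 1) (const_mx 1))%:E)%E.

Let mB : measurable B := measurable_row_of_tuple_ball u0 e.
Let nuB : lebesgue_tuple R n B = ((e *+ 2) ^+ n)%:E := lebesgue_tuple_ball u0 e0.
Let nuBoo : (lebesgue_tuple R n B < +oo)%E.
Proof. by rewrite nuB ltry. Qed.
(** Restricting to [B] gives a finite measure, to which Tonelli's theorem applies. *)
Let mu := mfrestr mB nuBoo.

Let f : n.-tuple R * R -> \bar R :=
  (fun z => (Num.sqrt (ev_tensor z.2 (cinv c (row z.1))))%:E)
  \_ (B `*` `[0%R, 1%R]).

Let f_ge0 z : (0 <= f z)%E.
Proof. by rewrite /f /patch; case: ifP => // _; rewrite lee_fin. Qed.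

(** Putting the time in front of the tuple turns the integrand into a continuous function on the
    domain of the joint plot [path_chart_plot]. *)
Let f_measurable : measurable_fun setT f.
Proof.
have mS : measurable (B `*` `[0%R, 1%R] : set (n.-tuple R * R)).
  exact: measurableX.
suff mf : measurable_fun (B `*` `[0%R, 1%R] : set (n.-tuple R * R))
    (fun z => Num.sqrt (ev_tensor z.2 (cinv c (row z.1)))).
  by apply/(measurable_restrictT _ mS)/measurable_EFinP.
pose b (r : 'rV[R]_n.+1) := Num.sqrt (tensor gN (path_chart_plot gam Ac) r
  (delta_mx ord0 ord0) (delta_mx ord0 ord0)).
pose U := pdom (path_chart_plot gam Ac).
pose cn (z : n.-tuple R * R) := [tuple of z.2 :: z.1] : n.+1.-tuple R.
have rcn z : row_of_tuple (cn z) = row_cons z.2 (row z.1).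
  exact: row_of_tuple_cons.
have oU : open U by exact: chart_domain_open.
apply: (eq_measurable_fun ((b \o row_of_tuple (n := n.+1)) \o cn)).
  move=> z; rewrite inE => -[/= Bz _]; rewrite /comp rcn /b.
  by rewrite -ev_tensor_chart//; exact: u0c.
apply: (measurable_comp (F := row_of_tuple (n := n.+1) @^-1` U)).
- exact: measurable_row_of_tuple_open.
- move=> _ [z [Bz _] <-] /=; rewrite rcn.
  suff : (cmap c @` cdom c) (row_behead (row_cons z.2 (row z.1))) by [].
  by rewrite row_behead_cons; exact: u0c.
- apply: measurable_fun_row_of_tuple => // r Ur.
  apply: continuous_comp; last exact: sqrt_continuous.
  exact: tensor_continuous.
apply: (measurable_funS measurableT) => //.
exact: measurable_tuple_cons.
Qed.

Let F x := path_length gN (ev_path (cinv c (row x))).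

Let F_fubini x : (F \_ B) x = fubini_F (@lebesgue_measure R) f x.
Proof.
rewrite /fubini_F /patch; case: ifPn => Bx; last first.
  rewrite integral0_eq// => y _; rewrite /f patchN//; apply: contra Bx.
  by rewrite !inE => -[].
rewrite /F ev_path_length [LHS]integral_mkcond; apply: eq_integral => t _.
rewrite /f /patch; case: ifPn; case: ifPn => //.
  by move=> /negP A t01; case: A; move: Bx t01; rewrite !inE.
by rewrite inE => -[_ /=] t01 /negP[]; rewrite inE.
Qed.

Lemma ev_path_length_measurable : measurable_fun B F.
Proof.
apply/(measurable_restrictT _ mB).
rewrite (_ : _ \_ _ = fubini_F (@lebesgue_measure R) f); last exact/funext/F_fubini.
exact: measurable_fun_fubini_tonelli_F.
Qed.

(** The constant of [integral_le_sqrt_integral_sq] for a ball of measure [(2 e)^n]. *)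
Let C := (k^-1 + (e *+ 2) ^+ n) / 2.

(** Tonelli's theorem moves the time integral outside. At each time, the integral over [B] of the
    speeds is at most [C] times the root of [g] along [gam], by [integral_le_sqrt_integral_sq] and
    [Hk]. *)
Lemma int_ev_path_length_le :
  (\int[lebesgue_tuple R n]_(x in B) F x <= C%:E * path_length g gam)%E.
Proof.
have nu_mu h : (\int[mu]_(x in B) h x = \int[lebesgue_tuple R n]_(x in B) h x)%E.
  apply: eq_measure_integral => A mA AB.
  transitivity (lebesgue_tuple R n (A `&` B)) => //.
  by rewrite (setIidl AB).
rewrite -nu_mu integral_mkcond.
rewrite (eq_integral (fubini_F (@lebesgue_measure R) f)); last first.
  by move=> x _; exact: F_fubini.
rewrite fubini_tonelli//.
have C0 : 0 <= C.
  by rewrite divr_ge0// addr_ge0 ?invr_ge0 ?ltW// exprn_gt0// mulrn_wgt0.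
pose s t := tensor g (path_plot gam) (const_mx t) (const_mx 1) (const_mx 1).
have ms : measurable_fun (`[0%R, 1%R] : set R) (fun t => (Num.sqrt (s t))%:E).
  by apply/measurable_EFinP; exact: path_speed_measurable.
rewrite /path_length -ge0_integralZl//.
rewrite [leRHS]integral_mkcond; apply: ge0_le_integral => //.
- by move=> y _; apply: integral_ge0.
- exact: (measurable_fun_fubini_tonelli_G (m1 := mu)).
- by apply/(measurable_restrictT _ (measurable_itv _)); exact: measurable_funeM.
move=> t _; rewrite [leRHS]/patch; case: ifPn => t01; last first.
  rewrite integral0_eq// => x _; rewrite /f patchN//; apply: contra t01.
  by rewrite !inE => -[].
rewrite inE in t01.
rewrite (_ : (\int[_]_x _)%E = (\int[lebesgue_tuple R n]_(x in B)
    (Num.sqrt (ev_tensor t (cinv c (row x))))%:E)%E); last first.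
  rewrite -nu_mu [RHS]integral_mkcond; apply: eq_integral => x _.
  rewrite /f /patch; case: ifPn; case: ifPn => //.
    by move=> /negP A; rewrite !inE => -[Bx _]; case: A; rewrite inE.
  by rewrite inE => Bx /negP[]; rewrite inE.
apply: integral_le_sqrt_integral_sq => //.
- apply: measurableT_comp.
    by apply: continuous_measurable_fun => s'; exact: sqrt_continuous.
  apply: measurable_funS (ev_tensor_measurable t Ac).
    by apply: measurable_row_of_tuple_open; exact: cimage_open.
  by move=> x; exact: u0c.
- exact: wr_ge0.
apply: le_trans (Hk t); rewrite lee_pmul2l// le_eqVlt; apply/orP; left; apply/eqP.
by apply: eq_integral => x _; rewrite sqr_sqrtr// ev_tensor_ge0.
Qed.

End PathFunctionSpace.

(** * Maps at pseudodistance 0 agree on a dense set *)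

Lemma path_length_ge0 (R : realType) (X : diffspace R) (g : weak_riemannian X)
    (x y : X) (c : Defs.path x y) : (0 <= path_length g c)%E.
Proof. by apply: integral_ge0 => t _; rewrite lee_fin. Qed.

Lemma pseudodist_ge0 (R : realType) (X : diffspace R) (g : weak_riemannian X)
    (x y : X) : (0 <= pseudodist g x y)%E.
Proof. by apply/ereal_infP => _ [c _ <-]; exact: path_length_ge0. Qed.

Lemma pseudodist_le (R : realType) (X : diffspace R) (g : weak_riemannian X)
    (x y : X) (c : Defs.path x y) : (pseudodist g x y <= path_length g c)%E.
Proof. by apply: ereal_inf_lbound; exists c. Qed.

Lemma le_inv_natS_eq0 (R : realType) (x : \bar R) (C : R) : (0 <= x)%E -> 0 <= C ->
  (forall j : nat, (x <= C%:E * (j.+1%:R^-1)%:E)%E) -> x = 0%E.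
Proof.
move=> x0 C0 xC; apply/eqP; rewrite eq_le x0 andbT.
apply/lee_addgt0Pr => e e0; rewrite add0e.
have e'0 : 0 < e / (C + 1) by rewrite divr_gt0// ltr_wpDl.
have [k _ /(_ k (leqnn k)) /= ke] := near_infty_natSinv_lt (PosNum e'0).
apply: le_trans (xC k) _; rewrite -EFinM lee_fin.
apply: (@le_trans _ _ (C * (e / (C + 1)))); first by rewrite ler_wpM2l// ltW.
rewrite [leLHS](_ : _ = e * (C / (C + 1))); last by ring.
by rewrite ger_pMr// ler_pdivrMr ?ltr_wpDl// mul1r lerDl.
Qed.

(** A nonnegative function with integral 0 vanishes almost everywhere; if it vanished nowhere on
    [B], then [B] would lie in a null set. *)
Lemma integral_eq0_exists d (T : measurableType d) (R : realType)
    (mu : {measure set T -> \bar R}) (B : set T) (f : T -> \bar R) :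
  measurable B -> (0 < mu B)%E -> measurable_fun B f ->
  (forall x, B x -> (0 <= f x)%E) -> (\int[mu]_(x in B) f x)%E = 0%E ->
  exists2 x, B x & f x = 0%E.
Proof.
move=> mB muB mf f0 If; apply: contrapT => H.
have /(ae_eq_integral_abs mu mB mf)[A [mA muA0 BA]] :
    (\int[mu]_(x in B) `|f x|)%E = 0%E.
  by rewrite -If; apply: eq_integral => x /[!inE] Bx; rewrite gee0_abs// f0.
suff : (mu B <= mu A)%E by rewrite muA0 leNgt muB.
apply: le_measure; rewrite ?inE// => x Bx; apply: BA => /= /(_ Bx) fx.
by apply: H; exists x.
Qed.

Section Density.
Variables (R : realType) (M : closed_manifold R) (vol : volume_form M).
Variables (N : diffspace R) (gN : weak_riemannian N).
Variable g : weak_riemannian (func_space (manifold_space M) N).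
Hypothesis g_def : forall (P : plot (func_space (manifold_space M) N))
    (r v w : 'rV[R]_(pdim P)), pdom P r ->
  (tensor g P r v w)%:E = form_integral vol
    (fun m : M => tensor gN (plot_map (ev_smooth (manifold_space M) N m) P) r v w).
Hypothesis dN : is_distance (pseudodist gN).

Lemma pseudodist0_dense (f0 f1 : func_space (manifold_space M) N) (W : set M) :
  pseudodist g f0 f1 = 0%E -> open W -> W !=set0 ->
  exists2 m, W m & sval f0 m = sval f1 m.
Proof.
move=> d0 oW W0.
have [c [u [e [k [Ac e0 k0 ue H]]]]] := form_integral_chart vol oW W0.
have gamP (j : nat) : exists gam : Defs.path f0 f1,
    (path_length g gam <= (j.+1%:R^-1)%:E)%E.
  have [|_ [gam _ <-] gamj] :=
    @ereal_inf_lt _ [set path_length g c | c in [set: Defs.path f0 f1]] (j.+1%:R^-1)%:E.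
    by rewrite -/(pseudodist g f0 f1) d0 lte_fin invr_gt0 ltr0Sn.
  by exists gam; exact: ltW.
pose gam j := sval (cid (gamP j)).
have gamj j : (path_length g (gam j) <= (j.+1%:R^-1)%:E)%E.
  by rewrite /gam; case: cid.
have uec : ball u e `<=` cmap c @` cdom c by move=> y /ue[].
pose row := @row_of_tuple R (mdim M).
pose F j x := path_length gN (ev_path (gam j) (cinv c (row x))).
pose C := (k^-1 + (e *+ 2) ^+ mdim M) / 2.
have C0 : 0 <= C.
  by rewrite divr_ge0// addr_ge0 ?invr_ge0 ?ltW// exprn_gt0// mulrn_wgt0.
have Hk j t : (k%:E * \int[lebesgue_tuple R (mdim M)]_(x in row @^-1` ball u e)
    (ev_tensor gN (gam j) t (cinv c (row x)))%:E <=
    (tensor g (path_plot (gam j)) (const_mx t) (const_mx 1) (const_mx 1))%:E)%E.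
  rewrite g_def//; apply: H; first by move=> m; exact: ev_tensor_ge0.
  exact: ev_tensor_measurable.
have mF j : measurable_fun (row @^-1` ball u e) (F j).
  exact: (ev_path_length_measurable gN (gam j) Ac uec).
have IF j : (\int[lebesgue_tuple R (mdim M)]_(x in row @^-1` ball u e) F j x
    <= C%:E * (j.+1%:R^-1)%:E)%E.
  apply: le_trans (int_ev_path_length_le Ac e0 k0 uec (Hk j)) _.
  by rewrite lee_wpmul2l// lee_fin.
have mB := measurable_row_of_tuple_ball u e.
(* The infimum over all [j]. Its integral is below that of every [F j], hence 0, without any
   pointwise convergence of the lengths. *)
pose G x := einfs (F ^~ x) 0%N.
have mG : measurable_fun (row @^-1` ball u e) G by exact: measurable_fun_einfs.
have G0 x : (0 <= G x)%E.
  by apply/ereal_infP => _ [j _ <-]; exact: path_length_ge0.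
have GF x j : (G x <= F j x)%E by apply: ereal_inf_lbound; exists j.
have [|||x Bx Gx] := @integral_eq0_exists _ _ _ (lebesgue_tuple R (mdim M)) _ G mB _ mG.
- by rewrite lebesgue_tuple_ball// lte_fin exprn_gt0// mulrn_wgt0.
- by [].
- apply: (le_inv_natS_eq0 _ C0); first by apply: integral_ge0.
  move=> j; apply: le_trans (IF j); apply: ge0_le_integral => //.
exists (cinv c (row x)); first by have [_] := ue _ Bx.
apply: dN; apply/eqP; rewrite eq_le pseudodist_ge0 andbT -Gx.
apply/ereal_infP => _ [j _ <-]; exact: pseudodist_le.
Qed.

End Density.

(** * Flat functions and a smooth plateau *)

Section Flat.
Variable R : realType.

(* [x^-j exp(-1/x)] for [x > 0], extended by 0; this family is closed under
   derivation up to linear combinations, see [is_derive_flat]. *)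
Definition flat (j : nat) (x : R) : R :=
  if 0 < x then x^-1 ^+ j * expR (- x^-1) else 0.

Lemma flat_ge0 j x : 0 <= flat j x.
Proof.
rewrite /flat; case: ifP => // x0.
by rewrite mulr_ge0 ?expR_ge0// exprn_ge0 ?invr_ge0 ?ltW.
Qed.

(** With [y = 1/x], this is [y^(j+1) / (j+1)! <= exp y]. It controls the difference quotient of
    [flat] at 0. *)
Lemma flat_le_fact j x : flat j.+1 x <= j.+1`!%:R.
Proof.
rewrite /flat; case: ifPn => [x0|_]; last by rewrite ler0n.
rewrite expRN ler_pdivrMr ?expR_gt0// mulrC -ler_pdivrMr ?ltr0n ?fact_gt0//.
have := @expR_ge1Dxn R x^-1 j; rewrite invr_ge0 => /(_ (ltW x0)).
by apply: le_trans; rewrite lerDr.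
Qed.

Lemma flat0_le1 x : flat 0 x <= 1.
Proof.
rewrite /flat; case: ifPn => // x0.
by rewrite expr0 mul1r -expR0 ler_expR oppr_le0 invr_ge0 ltW.
Qed.

Lemma is_derive_flat j (x : R) :
  is_derive x (1 : R) (flat j) (flat j.+2 x - j%:R * flat j.+1 x).
Proof.
have [x0|x0|<-] := ltgtP 0 x.
- have E : \near x, ((GRing.inv : R -> R) ^+ j *
      (expR \o (- (GRing.inv : R -> R)))) x = flat j x.
    near=> y; rewrite /flat ifT; last by near: y; exact: lt_nbhsr.
    by rewrite !fctE.
  apply: near_eq_is_derive E _.
  have dV : is_derive x (1 : R) (GRing.inv : R -> R) (- x ^- 2).
    by have := @is_deriveV R id x 1 1 (lt0r_neq0 x0) _; rewrite [_ *: 1]mulr1; apply.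
  apply: is_derive_eq; rewrite /flat x0 /= !fctE /= /GRing.scale /=.
  rewrite -exprVn; set e := expR _; set u := (x^-1); move: e u => e u.
  case: j => [|j]; rewrite /= !expr2 ?exprS ?expr0.
    by ring.
  by ring.
- have E : \near x, cst 0 x = flat j x.
    near=> y; rewrite /flat ltNge ltW//.
    by near: y; exact: lt_nbhsl.
  apply: near_eq_is_derive E _; rewrite /flat !(ltNge 0) (ltW x0)/= mulr0 subr0.
  exact: is_derive_cst.
have F0 i : flat i 0 = 0 by rewrite /flat ltxx.
rewrite !F0 mulr0 subr0.
suff D0 : (fun h => h^-1 *: (flat j (h *: 1 + 0) - flat j 0)) @ 0^' --> (0 : R).
  by apply: DeriveDef; [apply/cvg_ex; exists 0|exact: cvg_lim].
apply/cvgr0Pnorm_le => e e0; near=> h.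
rewrite addr0 F0 subr0 [h *: 1]mulr1 /GRing.scale /=.
rewrite /flat; case: ifPn => h0; last by rewrite mulr0 normr0 ltW.
rewrite ger0_norm; last by rewrite !mulr_ge0 ?expR_ge0 ?exprn_ge0 ?invr_ge0 ?ltW.
rewrite mulrA -exprS.
(* The quotient is now [flat j.+1 h]; the bound on [flat j.+2 h] shows that it is at most
   [h * (j+2)!]. *)
have := flat_le_fact j.+1 h; rewrite /flat h0 exprS -mulrA ler_pdivrMl//.
move=> /le_trans; apply.
rewrite -ler_pdivlMr ?ltr0n ?fact_gt0// -[h]gtr0_norm//.
near: h; apply: dnbhs0_le; rewrite divr_gt0// ltr0n fact_gt0.
Unshelve. all: by end_near. Qed.

Lemma derive_coord_comp m (f : R -> R) (df : R) (t : 'rV[R]_m) i v :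
  is_derive (t ord0 i) (1 : R) f df ->
  differentiable (fun s : 'rV[R]_m => f (s ord0 i)) t /\
  'D_v (fun s : 'rV[R]_m => f (s ord0 i)) t = v ord0 i * df.
Proof.
move=> dF; have [fd fE] := dF.
have {}fd : differentiable f (t ord0 i) by exact/derivable1_diffP.
pose cd (s : 'rV[R]_m) : R := s ord0 i.
have cdD : differentiable cd t.
  exact: (@smooth_on_coord R m setT i openT 1%N).1.
split; first exact: (differentiable_comp cdD fd).
rewrite deriveE; last exact: (differentiable_comp cdD fd).
rewrite (diff_comp cdD fd) /= diff1E//= -deriveE// derive1E fE.
congr (_ * _); apply: derive_affine => s.
by rewrite /cd !mxE.
Qed.

(** Induction on the order [k] for all [j] at once, since derivation raises [j]. *)
Lemma flat_smooth m i j : smooth_on setT (fun t : 'rV[R]_m => flat j (t ord0 i)).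
Proof.
move=> k; elim: k j => [|k IH] j.
  move=> t _; apply: differentiable_continuous.
  exact: (derive_coord_comp 0 (is_derive_flat j (t ord0 i))).1.
split=> [t _|v].
  exact: (derive_coord_comp 0 (is_derive_flat j (t ord0 i))).1.
have oT : open [set: 'rV[R]_m] by exact: openT.
have C (x : R) : Ck k [set: 'rV[R]_m] (cst x) by exact: Ck_cst.
apply: (Ck_ext oT _ (Ck_scale oT (C (v ord0 i))
  (CkD oT (IH j.+2) (Ck_scale oT (C (- j%:R)) (IH j.+1))))) => t _ /=.
rewrite (derive_coord_comp v (is_derive_flat j (t ord0 i))).2.
by rewrite fctE /GRing.scale /= mulNr.
Qed.

(* [a] vanishes around 1/2, so that a path moving along [a] rests there and can
   be glued smoothly to another one. It need not stay in [0, 1], hence [A]. *)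
Lemma plateau_exists : exists (a : 'rV[R]_1 -> R) (A L : R),
  [/\ smooth_on setT a, a (const_mx 0) = 1 /\ a (const_mx 1) = 1,
      forall t, 1 / 4%:R < t -> t < 3%:R / 4%:R -> a (const_mx t) = 0,
      forall t, `|a t| <= A &
      forall t, 0 <= t <= 1 -> `|'D_(const_mx 1) a (const_mx t)| <= L].
Proof.
(* This quadratic is nonpositive exactly on [[1/4, 3/4]], where [flat 0] of it vanishes, and equals
   3/16 at 0 and 1, whence the normalization by [k0]. *)
pose q (t : 'rV[R]_1) : 'rV[R]_1 := const_mx ((t ord0 ord0 - 1 / 2) ^+ 2 - 1 / 16).
have oT : open [set: 'rV[R]_1] by exact: openT.
have C k (x : R) : Ck k [set: 'rV[R]_1] (cst x) by exact: Ck_cst.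
have sq : smooth_on setT q.
  apply: smooth_on_row => // i k.
  have s1 : Ck k setT (fun t : 'rV[R]_1 => t ord0 ord0 - 1 / 2).
    by apply: (CkD oT _ (C k (- (1 / 2)))); exact: smooth_on_coord.
  apply: (Ck_ext oT _ (CkD oT (Ck_scale oT s1 s1) (C k (- (1 / 16))))) => t _.
  by rewrite mxE expr2.
pose k0 := flat 0 (3 / 16).
have k00 : 0 < k0.
  by rewrite /k0 /flat ifT ?divr_gt0// expr0 mul1r expR_gt0.
pose a (t : 'rV[R]_1) := k0^-1 * flat 0 (q t ord0 ord0).
have sa : smooth_on setT a.
  move=> k; apply: (Ck_scale oT (C k k0^-1)).
  apply: (smooth_on_comp oT _ sq (@flat_smooth 1 ord0 0)) => //.
have cD : continuous (fun t : R => `|'D_(const_mx 1) a (const_mx t)|).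
  move=> t; apply: (continuous_comp (g := Num.norm)
    (f := fun t : R => 'D_(const_mx 1) a (const_mx t))); last exact: norm_continuous.
  apply: (continuous_comp (f := fun t : R => const_mx t : 'rV[R]_1)
    (g := 'D_(const_mx 1) a)); first exact: const_mx_continuous.
  exact: ((sa 1%N).2 (const_mx 1)).
have [x _ xL] := EVT_max (@ler01 R) (continuous_subspaceT cD).
exists a, k0^-1, `|'D_(const_mx 1) a (const_mx x)|; split=> //.
- have E : k0^-1 * flat 0 (3 / 16) = 1 by rewrite mulVf// lt0r_neq0.
  split; rewrite /a /q !mxE -[RHS]E; congr (_ * flat _ _); by field.
- move=> t t1 t3; rewrite /a /q !mxE /flat ifF ?mulr0//.
  by apply/negbTE; rewrite -leNgt; nra.
- move=> t; rewrite /a ger0_norm; last by rewrite mulr_ge0 ?flat_ge0// invr_ge0 ltW.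
  by apply: ler_piMr; [rewrite invr_ge0 ltW|exact: flat0_le1].
Qed.

End Flat.

(** * Gluing two plots along a path, and the length of a short detour *)

Lemma tensor_local (R : realType) (X : diffspace R) (g : T2 X -> R)
    (P Q : plot X) (V : set 'rV[R]_(pdim P))
    (h : 'rV[R]_(pdim P) -> 'rV[R]_(pdim Q)) r v w :
  open V -> V `<=` pdom P -> smooth_on V h ->
  (forall s, V s -> pdom Q (h s)) ->
  (forall s, V s -> Defs.pmap Q (h s) = Defs.pmap P s) -> V r ->
  tensor g P r v w = tensor g Q (h r) ('D_v h r) ('D_w h r).
Proof.
(* The restriction of [P] to [V] has morphisms to both [P] and [Q], the inclusion and [h]. *)
move=> oV VP sh hQ hE Vr.
have sid : smooth_on V id by move=> k; exact: Ck_id.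
pose PV := Plot (plot_comp oV sid VP (pmapP P)).
rewrite -(@tensor_comp _ _ g PV Q h r v w)//.
by rewrite (@tensor_comp _ _ g PV P id r v w)// !derive_id.
Qed.

Lemma tensor_locally_bounded (R : realType) (X : diffspace R)
    (g : weak_riemannian X) (P : plot X) r : pdom P r ->
  exists2 B, 0 <= B & \forall s \near r, forall i j,
    `|tensor g P s (delta_mx ord0 i) (delta_mx ord0 j)| <= B.
Proof.
move=> Pr.
pose T i j s := `|tensor g P s (delta_mx ord0 i) (delta_mx ord0 j)|.
(* The added 1 makes the bound strict at [r], so that it persists nearby for each of the finitely
   many components. *)
pose B := 1 + \sum_i \sum_j T i j r.
have TB i j : T i j r < B.
  rewrite /B (bigD1 i)//= (bigD1 j)//= -!addrA ltr_pwDl// lerDl.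
  by rewrite addr_ge0//; do !apply: sumr_ge0 => ? _; exact: normr_ge0.
exists B.
  by rewrite addr_ge0//; do !apply: sumr_ge0 => ? _; exact: normr_ge0.
near=> s; suff : forall ij : 'I_(pdim P) * 'I_(pdim P),
  `|tensor g P s (delta_mx ord0 ij.1) (delta_mx ord0 ij.2)| <= B.
  by move=> sB i j; exact: (sB (i, j)).
near: s; apply: filter_forall => -[i j] /=.
apply: (cvgr_norm_le _ (@tensor_continuous _ _ g P (delta_mx ord0 i)
  (delta_mx ord0 j) r Pr)); exact: TB i j.
Unshelve. all: by end_near. Qed.

Section Glue.
Variables (R : realType) (X : diffspace R) (g : weak_riemannian X).
Variables (n : nat) (U : set 'rV[R]_n) (p0 p1 : 'rV[R]_n -> X).
Hypotheses (P0 : is_plot X U p0) (P1 : is_plot X U p1).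
Variables (h : 'rV[R]_1 -> 'rV[R]_n).
Hypotheses (sh : smooth_on setT h) (hU : forall t, U (h t)).
Hypothesis h01 : forall t : R, 1 / 4%:R < t -> t < 3%:R / 4%:R ->
  p0 (h (const_mx t)) = p1 (h (const_mx t)).

(** The switch at 1/2 lies inside the interval where [p0 \o h] and [p1 \o h] agree. Hence the path
    is [p0 \o h] on [Vl] and [p1 \o h] on [Vr], two open sets covering the line. *)
Definition glue (t : R) : X :=
  if t < 1 / 2 then p0 (h (const_mx t)) else p1 (h (const_mx t)).

Let Vl : set 'rV[R]_1 := [set t | t ord0 ord0 < 3%:R / 4%:R].
Let Vr : set 'rV[R]_1 := [set t | 1 / 4%:R < t ord0 ord0].

Let const_mxE (t : 'rV[R]_1) : const_mx (t ord0 ord0) = t.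
Proof. by apply/rowP => i; rewrite mxE !ord1. Qed.

Let coord_cont (t : 'rV[R]_1) : {for t, continuous (fun s : 'rV[R]_1 => s ord0 ord0)}.
Proof. exact: (@smooth_on_coord R 1 setT ord0 openT 0%N). Qed.

Let Vl_open : open Vl.
Proof.
rewrite -[Vl]setTI; apply: (open_preimage_in (V := [set x : R | x < _])) => //.
exact: openT.
Qed.

Let Vr_open : open Vr.
Proof.
rewrite -[Vr]setTI; apply: (open_preimage_in (V := [set x : R | _ < x])) => //.
exact: openT.
Qed.

Let glue_l t : Vl t -> p0 (h t) = glue (t ord0 ord0).
Proof.
rewrite /Vl /glue /= const_mxE => t3; case: ltP => // t2.
by have := h01 _ t3; rewrite const_mxE; apply; lra.
Qed.

Let glue_r t : Vr t -> p1 (h t) = glue (t ord0 ord0).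
Proof.
rewrite /Vr /glue /= const_mxE => t1; case: ltP => // t2.
by have := h01 t1; rewrite const_mxE => ->//; lra.
Qed.

Lemma glue_plot : is_plot X setT (fun t : 'rV[R]_1 => glue (t ord0 ord0)).
Proof.
have sV (V : set 'rV[R]_1) : smooth_on V h by exact: smooth_on_sub sh.
apply: plot_local => [|t _]; first exact: openT.
have [t3|t3] := ltP (t ord0 ord0) (3%:R / 4%:R).
  exists Vl; split=> //; apply: (plot_ext glue_l).
  exact: (plot_comp Vl_open (sV _) _ P0).
exists Vr; split=> //.
  by rewrite /Vr /=; apply: lt_le_trans t3; lra.
apply: (plot_ext glue_r).
exact: (plot_comp Vr_open (sV _) _ P1).
Qed.

Lemma glue0 : glue 0 = p0 (h (const_mx 0)).
Proof. by rewrite /glue ifT. Qed.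

Lemma glue1 : glue 1 = p1 (h (const_mx 1)).
Proof. by rewrite /glue ifF//; apply/negbTE; rewrite -leNgt; lra. Qed.

Definition glue_path : Defs.path (p0 (h (const_mx 0))) (p1 (h (const_mx 1))) :=
  Path glue_plot glue0 glue1.

Lemma tensor_glue t v w :
  tensor g (path_plot glue_path) t v w =
    tensor g (Plot P0) (h t) ('D_v h t) ('D_w h t) \/
  tensor g (path_plot glue_path) t v w =
    tensor g (Plot P1) (h t) ('D_v h t) ('D_w h t).
Proof.
have sV (V : set 'rV[R]_1) : smooth_on V h by exact: smooth_on_sub sh.
have [t3|t3] := ltP (t ord0 ord0) (3%:R / 4%:R).
  left; apply: (@tensor_local _ _ g (path_plot glue_path) (Plot P0) Vl) => //.
  by move=> s _; exact: hU.
right; apply: (@tensor_local _ _ g (path_plot glue_path) (Plot P1) Vr) => //.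
  by move=> s _; exact: hU.
by rewrite /Vr /=; apply: lt_le_trans t3; lra.
Qed.

Lemma pseudodist_glue (B : R) : 0 <= B ->
  (forall t, 0 <= t <= 1 -> forall p (P : is_plot X U p),
    p = p0 \/ p = p1 ->
    tensor g (Plot P) (h (const_mx t)) ('D_(const_mx 1) h (const_mx t))
      ('D_(const_mx 1) h (const_mx t)) <= B ^+ 2) ->
  (pseudodist g (p0 (h (const_mx 0%R))) (p1 (h (const_mx 1%R))) <= B%:E)%E.
Proof.
move=> B0 HB; apply: le_trans (pseudodist_le g glue_path) _.
apply: (@le_trans _ _ (\int[@lebesgue_measure R]_(t in `[0%R, 1%R]) B%:E)%E).
  apply: ge0_le_integral => //.
    by apply/measurable_EFinP; exact: path_speed_measurable.
  move=> t /=; rewrite in_itv/= => t01; rewrite lee_fin -[leRHS](ger0_norm B0) -sqrtr_sqr.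
  apply: ler_wsqrtr.
  by have [->|->] := tensor_glue (const_mx t) (const_mx 1) (const_mx 1);
    apply: HB => //; [left|right].
rewrite integral_cst// -[leRHS]mule1; apply: lee_wpmul2l => //.
have := @lebesgue_measure_itv R `[0%R, 1%R]; rewrite /= lte_fin ltr01 sube0.
by move=> <-.
Qed.

End Glue.

Lemma derive_addZl (R : realType) (V W : normedModType R) (a : V -> R) (b w : W)
    x v : derivable a x v ->
  'D_v (fun t => b + (a t - 1) *: w) x = 'D_v a x *: w.
Proof.
move=> da; apply/cvg_lim => //.
rewrite [X in X @ _ --> _](_ : _ =
    fun s => (s^-1 *: (a (s *: v + x) - a x)) *: w); last first.
  apply/funext => s /=.
  rewrite opprD addrACA subrr add0r -scalerBl opprB addrA subrK.
  exact: scalerA.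
exact: cvgZr_tmp.
Qed.

Lemma pseudodist_near (R : realType) (X : diffspace R) (g : weak_riemannian X)
    n (U : set 'rV[R]_n) (p0 p1 : 'rV[R]_n -> X) (u0 : 'rV[R]_n) (e : R) :
  is_plot X U p0 -> is_plot X U p1 -> U u0 -> 0 < e ->
  \forall u \near u0, p0 u = p1 u ->
    (pseudodist g (p0 u0) (p1 u0) <= e%:E)%E.
Proof.
move=> P0 P1 Uu0 e0; have oU := plot_open P0.
have [a [A [L [sa [a0 a1] amid aA aL]]]] := plateau_exists R.
have A0 : 0 <= A by exact: le_trans (aA 0).
have L0 : 0 <= L by apply: le_trans (aL 0 _); rewrite ?lexx ?ler01.
have [B0 B00 B0P] := @tensor_locally_bounded _ _ g (Plot P0) u0 Uu0.
have [B1 B10 B1P] := @tensor_locally_bounded _ _ g (Plot P1) u0 Uu0.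
have : nbhs u0 (U `&` ([set s : 'rV[R]_n | forall i j, `|tensor g (Plot P0) s
    (delta_mx ord0 i) (delta_mx ord0 j)| <= B0] `&`
    [set s : 'rV[R]_n | forall i j, `|tensor g (Plot P1) s
    (delta_mx ord0 i) (delta_mx ord0 j)| <= B1])).
  apply: filterI; first exact: open_nbhs_nbhs.
  exact: filterI.
move=> /nbhs_ballP[rho /= rho0 Hrho].
pose B := B0 + B1; have B_ge0 : 0 <= B by exact: addr_ge0.
(* On [[0, 1]] the velocity of [h] below has norm at most [L * |w|]; with [tensor_bound], the speed
   of the glued path is at most [K * |w|]. *)
pose K := L * n%:R * Num.sqrt B.
have K0 : 0 <= K by rewrite !mulr_ge0// sqrtr_ge0.
(* The first term keeps [h], which moves at most [(A + 1) * |w|] away from [u0], in the ball where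
   the tensors are bounded; the second makes the length at most [e]. *)
pose d := Num.min (rho / (A + 1)) (e / (K + 1)).
have d0 : 0 < d by rewrite lt_min !divr_gt0// ltr_wpDl.
apply/nbhs_ballP; exists d => // u; rewrite -ball_normE /= lt_min => /andP[w1 w2] pu.
pose w := u0 - u; rewrite -/w in w1 w2.
(* It is at [u0] where [a] is 1 and at [u] where [a] vanishes: from [u0] to [u], a rest there while
   the plots are switched, and back. *)
pose h t := u0 + (a t - 1) *: w.
have hrho t : ball u0 rho (h t).
  rewrite -ball_normE /= /h opprD addNKr normrN normrZ.
  move: w1; rewrite ltr_pdivlMr ?ltr_wpDl// mulrC; apply: le_lt_trans.
  rewrite ler_wpM2r//; apply: (le_trans (ler_normB _ _)).
  by rewrite normr1 lerD2r.
have oT : open [set: 'rV[R]_1] by exact: openT.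
have sh : smooth_on setT h.
  move=> k; apply: CkD => //; first exact: Ck_cst.
  apply: Ck_scale => //; last exact: Ck_cst.
  by apply: (CkD oT (sa k)); exact: Ck_cst.
have hU t : U (h t) by have [] := Hrho _ (hrho t).
have h01 t : 1 / 4%:R < t -> t < 3%:R / 4%:R ->
    p0 (h (const_mx t)) = p1 (h (const_mx t)).
  move=> t1 t3; rewrite /h amid// sub0r scaleN1r /w opprB addrC subrK//.
have hE0 : h (const_mx 0) = u0 by rewrite /h a0 subrr scale0r addr0.
have hE1 : h (const_mx 1) = u0 by rewrite /h a1 subrr scale0r addr0.
have KB : 0 <= K * `|w| by rewrite mulr_ge0.
have := @pseudodist_glue _ _ g n U p0 p1 P0 P1 h sh hU h01 _ KB _.
rewrite hE0 hE1 => H; apply: (le_trans (H _)) => {H}; last first.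
  rewrite lee_fin; move: w2; rewrite ltr_pdivlMr ?ltr_wpDl// => /ltW.
  by apply: le_trans; rewrite mulrC ler_wpM2l// lerDl.
move=> t t01 p P pE.
rewrite derive_addZl; last first.
  by apply: diff_derivable; exact: (sa 1%N).1.
rewrite tensorZ//.
have PB (i j : 'I_n) : `|tensor g (Plot P) (h (const_mx t))
    (delta_mx ord0 i) (delta_mx ord0 j)| <= B.
  have [_ [H0 H1]] := Hrho _ (hrho (const_mx t)).
  case: pE P => -> P.
    rewrite (@tensor_irrelevance _ _ g n U _ P P0).
    by apply: (le_trans (H0 i j)); rewrite lerDl.
  rewrite (@tensor_irrelevance _ _ g n U _ P P1).
  by apply: (le_trans (H1 i j)); rewrite lerDr.
have : tensor g (Plot P) (h (const_mx t)) w w <= (`|w| * n%:R) ^+ 2 * B.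
  exact: tensor_bound.
have aL2 : ('D_(const_mx 1) a (const_mx t)) ^+ 2 <= L ^+ 2.
  by rewrite -[leLHS]real_normK ?num_real// ler_pXn2r ?nnegrE ?aL.
move=> TB; apply: (le_trans (ler_pM (sqr_ge0 _) _ aL2 TB)); first exact: wr_ge0.
by rewrite /K !exprMn sqr_sqrtr//; rewrite le_eqVlt; apply/orP; left; apply/eqP; ring.
Qed.

(** * From agreement on a dense set to equality *)

Theorem proposition5p2 (R : realType)
    (M : closed_manifold R) (M_orientable : orientable M)
    (vol : volume_form M)
    (N : diffspace R) (gN : weak_riemannian N) (N_connected : diff_connected N)
    (g : weak_riemannian (func_space (manifold_space M) N))
    (g_def : forall (P : plot (func_space (manifold_space M) N))
               (r v w : 'rV[R]_(pdim P)), pdom P r ->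
       (tensor g P r v w)%:E =
       form_integral vol
         (fun m : M =>
            tensor gN (plot_map (ev_smooth (manifold_space M) N m) P) r v w)) :
  is_distance (pseudodist gN) -> is_distance (pseudodist g).
Proof.
move=> dN f0 f1 d01; apply: eq_sig_hprop => [f s1 s2|].
  exact: Prop_irrelevance.
apply/funext => m.
have [c Ac cm] := atlas_cover m.
have P0 := svalP f0 _ _ _ (chart_plot Ac).
have P1 := svalP f1 _ _ _ (chart_plot Ac).
pose u0 := cmap c m; have cu0 : (cmap c @` cdom c) u0 by exists m.
apply: (dN); apply/eqP; rewrite eq_le pseudodist_ge0 andbT.
apply/lee_addgt0Pr => e e0; rewrite add0e.
have := pseudodist_near gN P0 P1 cu0 e0; rewrite /= /u0 cmapK//.
move=> /nbhs_ballP[d /= d0 Hd].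
(* The points whose coordinates are close enough to those of [m] for [pseudodist_near]; density
   provides one where the two maps agree. *)
pose W := cdom c `&` cmap c @^-1` ball (cmap c m) d.
have oW : open W.
  apply: open_preimage_in; [exact: cdom_open|exact: cmap_cont|exact: ball_open].
have W0 : W !=set0 by exists m; split=> //; exact: ballxx.
have [m' [cm' /Hd]] := pseudodist0_dense g_def dN d01 oW W0.
by rewrite cmapK// => H /H.
Qed.
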